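(* Let $(M,g)$ be a connected semi-Riemannian manifold, let $I$ be an open interval and let $\varepsilon,\widetilde\varepsilon\in\{1,-1\}$. Let $\Sigma$ be a Lie group acting by isometries on $M$ and let $\pi:(M,g)\to(I,\widetilde\varepsilon\,ds^2)$ be a semi-Riemannian submersion such that the fibers of $\pi$ are orbits of the action, with function $h:I\to\mathbb{R}$ representing the mean curvature of the orbits. Let $u\in C^2(M,\mathbb{R})$ and consider its graph map $F:M\to M\times\mathbb{R}$, $F(x)=(x,u(x))$, into $(M\times\mathbb{R},g+\varepsilon\,dt^2)$, assumed to be a semi-Riemannian hypersurface. Then $F$ is a $\Sigma$-invariant translating soliton if and only if there exists a solution $f\in C^2(I,\mathbb{R})$ to $$f''(s)=\big(\widetilde\varepsilon+\varepsilon f'(s)^2\big)\big(1-f'(s)h(s)\big),\qquad s\in I,$$ such that $u=f\circ\pi$.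
   Context: A semi-Riemannian submersion onto $(I,\widetilde\varepsilon\,ds^2)$ is a smooth surjective submersion with nondegenerate fibers such that $d\pi$ is a linear isometry from the orthogonal complement of $\ker d\pi$ onto the tangent space of $I$; regarding $\pi$ as a real function, $g(\nabla\pi,\nabla\pi)=\widetilde\varepsilon$. The mean curvature of the fibers is taken with respect to the unit normal $\nabla\pi$, so that the function $h$ representing it is characterized by $\mathrm{div}(\nabla\pi)=h\circ\pi$. A graph map $F(x)=(x,u(x))$ is a semi-Riemannian hypersurface if its induced metric is nondegenerate. It is a translating soliton if its mean curvature vector $\vec H$ (unnormalized trace of the second fundamental form) satisfies $\vec H=\partial_t^\perp$, where $\partial_t^\perp$ is the normal component of $\partial_t$. It is $\Sigma$-invariant if $u(\sigma\cdot x)=u(x)$ for all $x\in M$, $\sigma\in\Sigma$. *)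

(* Defs.v *)
From HB Require Import structures.
From mathcomp Require Import all_boot all_order all_algebra.
From mathcomp Require Import all_classical all_reals all_analysis.
Set Implicit Arguments.
Unset Strict Implicit.
Unset Printing Implicit Defensive.
Import Order.TTheory GRing.Theory Num.Theory.
Import numFieldNormedType.Exports.
Local Open Scope classical_set_scope.
Local Open Scope ring_scope.

(* Vectors are rows, so the Jacobian [jacobian f x] has the image of the a-th
   basis vector as its a-th row, and a linear map acts by v |-> v *m J.
   Tangent vectors at p are manipulated through their components in a chart
   around p; tensor fields are families of component functions, one for each
   chart, expressed in the coordinates of that chart. *)

(* f is of class C^k on U, for U an open set of a finite-dimensional space. *)
Fixpoint Ck (R : realType) (V W : normedModType R) (k : nat) (U : set V)
    (f : V -> W) : Prop :=
  if k is k'.+1 then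
    (forall x, U x -> differentiable f x) /\
    (forall v : V, Ck k' U (fun x => 'D_v f x : W))
  else forall x, U x -> {for x, continuous f}.

Definition smooth_on (R : realType) (V W : normedModType R) (U : set V)
    (f : V -> W) : Prop :=
  forall k, Ck k U f.

(* [chart_inv] is only meaningful on the image of the domain. *)
Record chart (R : realType) (T : topologicalType) (n : nat) := Chart {
  chart_dom : set T;
  chart_map :> T -> 'rV[R]_n;
  chart_inv : 'rV[R]_n -> T
}.

Definition chart_img (R : realType) (T : topologicalType) n
    (c : chart R T n) : set 'rV[R]_n :=
  c @` chart_dom c.

Definition is_chart (R : realType) (T : topologicalType) n
    (c : chart R T n) : Prop :=
  [/\ open (chart_dom c), open (chart_img c),
      forall p, chart_dom c p -> chart_inv c (c p) = p,
      forall p, chart_dom c p -> {for p, continuous c} &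
      forall y, chart_img c y -> {for y, continuous (chart_inv c)}].

Record charted_space (R : realType) (n : nat) := ChartedSpace {
  space :> topologicalType;
  chart_index : Type;
  chart_of : chart_index -> chart R space n
}.

Section Manifold.
Context {R : realType}.

Definition dom n (M : charted_space R n) (i : chart_index M) : set M :=
  chart_dom (chart_of i).

Definition coord n (M : charted_space R n) (i : chart_index M) :
    M -> 'rV[R]_n :=
  chart_map (chart_of i).

Definition local_map m n (M : charted_space R m) (N : charted_space R n)
    (F : M -> N) (i : chart_index M) (j : chart_index N) :
    'rV[R]_m -> 'rV[R]_n :=
  fun y => coord j (F (chart_inv (chart_of i) y)).

Definition local_fun n (M : charted_space R n) (u : M -> R)
    (i : chart_index M) : 'rV[R]_n -> R :=
  fun y => u (chart_inv (chart_of i) y).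

Definition smooth_manifold n (M : charted_space R n) : Prop :=
  [/\ hausdorff_space M, @second_countable M,
      forall i : chart_index M, is_chart (chart_of i),
      forall p : M, exists i : chart_index M, dom i p &
      forall i j : chart_index M,
        smooth_on (coord i @` (dom i `&` dom j)) (local_map id i j)].

Definition Ck_map m n (k : nat) (M : charted_space R m)
    (N : charted_space R n) (F : M -> N) : Prop :=
  continuous F /\
  forall (i : chart_index M) (j : chart_index N),
    Ck k (coord i @` (dom i `&` F @^-1` dom j)) (local_map F i j).

Definition smooth_map m n (M : charted_space R m) (N : charted_space R n)
    (F : M -> N) : Prop :=
  forall k, Ck_map k F.

Definition Ck_fun n (k : nat) (M : charted_space R n) (u : M -> R) : Prop :=
  forall i : chart_index M, Ck k (chart_img (chart_of i)) (local_fun u i).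

Definition smooth_fun n (M : charted_space R n) (u : M -> R) : Prop :=
  forall k, Ck_fun k u.

Definition prod_chart m n (S T : topologicalType) (c : chart R S m)
    (d : chart R T n) : chart R (S * T)%type (m + n) :=
  Chart (chart_dom c `*` chart_dom d)
        (fun p => row_mx (c p.1) (d p.2))
        (fun y => (chart_inv c (lsubmx y), chart_inv d (rsubmx y))).

Definition prod_space m n (M : charted_space R m) (N : charted_space R n) :
    charted_space R (m + n) :=
  @ChartedSpace R (m + n) (M * N)%type (chart_index M * chart_index N)%type
    (fun ij => prod_chart (chart_of ij.1) (chart_of ij.2)).

Definition real_line : charted_space R 1 :=
  @ChartedSpace R 1 R unit
    (fun=> @Chart R R 1 setT (fun x => const_mx x) (fun y => y ord0 ord0)).

Definition lie_group k (G : charted_space R k) (mul : G -> G -> G) (one : G)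
    (inv : G -> G) : Prop :=
  [/\ smooth_manifold G,
      [/\ associative mul, left_id one mul, right_id one mul,
          left_inverse one inv mul & right_inverse one inv mul],
      @smooth_map _ _ (prod_space G G) G (fun ab => mul ab.1 ab.2) &
      smooth_map inv].

Definition smooth_action k n (G : charted_space R k) (mul : G -> G -> G)
    (one : G) (M : charted_space R n) (act : G -> M -> M) : Prop :=
  [/\ forall x, act one x = x,
      forall a b x, act (mul a b) x = act a (act b x) &
      @smooth_map _ _ (prod_space G M) M (fun ax => act ax.1 ax.2)].

(* [g i y] is the Gram matrix, at the point with coordinates y in chart i, of
   the coordinate frame of that chart. *)
Definition tensor02 n (M : charted_space R n) : Type :=
  chart_index M -> 'rV[R]_n -> 'M[R]_n.

Definition scalar_product n (A : 'M[R]_n) (v w : 'rV[R]_n) : R :=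
  (v *m A *m w^T) ord0 ord0.

(* phi^* h = g, read in all pairs of charts *)
Definition preserves_metric m n (M : charted_space R m)
    (N : charted_space R n) (g : tensor02 M) (h : tensor02 N) (phi : M -> N) :
    Prop :=
  forall (i : chart_index M) (j : chart_index N) (p : M),
    dom i p -> dom j (phi p) ->
    let J := jacobian (local_map phi i j) (coord i p) in
    forall v w : 'rV[R]_m,
      scalar_product (h j (coord j (phi p))) (v *m J) (w *m J)
        = scalar_product (g i (coord i p)) v w.

(* The last clause is the transformation law of a tensor field of type (0,2).
   The index of the metric is locally constant, hence constant when M is
   connected. *)
Definition semi_riemannian_metric n (M : charted_space R n) (g : tensor02 M) :
    Prop :=
  [/\ forall (i : chart_index M) y,
        chart_img (chart_of i) y -> (g i y)^T = g i y,
      forall (i : chart_index M) y,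
        chart_img (chart_of i) y -> g i y \in unitmx,
      forall (i : chart_index M) a b,
        smooth_on (chart_img (chart_of i)) (fun y => g i y a b : R) &
      preserves_metric g g id].

(* Bijectivity is not required here; it is automatic for the maps act a of a
   group action. *)
Definition acts_by_isometries k n (G : charted_space R k)
    (M : charted_space R n) (g : tensor02 M) (act : G -> M -> M) : Prop :=
  forall a, preserves_metric g g (act a).

(* The metric g + e dt^2 on M x R. *)
Definition product_metric n (M : charted_space R n) (g : tensor02 M) (e : R) :
    tensor02 (prod_space M real_line) :=
  fun ij y => block_mx (g ij.1 (lsubmx y)) 0 0 e%:M.

Definition pd n (a : 'I_n) (f : 'rV[R]_n -> R) (y : 'rV[R]_n) : R :=
  'D_(delta_mx ord0 a) f y.

(* Gamma^c_{ab} of the Levi-Civita connection *)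
Definition christoffel n (G : 'rV[R]_n -> 'M[R]_n) (y : 'rV[R]_n)
    (c a b : 'I_n) : R :=
  2^-1 * \sum_(l < n) invmx (G y) c l *
    (pd a (fun z => G z b l) y + pd b (fun z => G z a l) y
     - pd l (fun z => G z a b) y).

Definition gradient n (G : 'rV[R]_n -> 'M[R]_n) (f : 'rV[R]_n -> R)
    (y : 'rV[R]_n) : 'rV[R]_n :=
  (\row_a pd a f y) *m invmx (G y).

(* Trace of the covariant derivative of X *)
Definition divergence n (G : 'rV[R]_n -> 'M[R]_n)
    (X : 'rV[R]_n -> 'rV[R]_n) (y : 'rV[R]_n) : R :=
  \sum_(a < n) (pd a (fun z => X z ord0 a) y
                + \sum_(b < n) christoffel G y a a b * X y ord0 b).

(* The target is (I, et ds^2); ker d pi is nondegenerate, and d pi maps its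
   orthogonal complement isometrically onto the tangent line of I. *)
Definition semi_riemannian_submersion n (M : charted_space R n)
    (g : tensor02 M) (I : set R) (et : R) (pi : M -> R) : Prop :=
  [/\ smooth_fun pi, range pi = I &
    forall (i : chart_index M) (p : M), dom i p ->
      let y := coord i p in
      let dpi (v : 'rV[R]_n) : R := 'D_v (local_fun pi i) y in
      let vertical v := dpi v = 0 in
      let horizontal v :=
        forall w, vertical w -> scalar_product (g i y) v w = 0 in
      [/\ forall v, vertical v -> horizontal v -> v = 0,
          forall r : R, exists2 v, horizontal v & dpi v = r &
          forall v w, horizontal v -> horizontal w ->
            scalar_product (g i y) v w = et * dpi v * dpi w]].

Definition fibers_are_orbits k n (G : charted_space R k)
    (M : charted_space R n) (act : G -> M -> M) (pi : M -> R) : Prop :=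
  forall x y : M, pi y = pi x <-> exists a : G, y = act a x.

(* The mean curvature of the fibers of pi with respect to the unit normal
   grad pi is h o pi, that is div (grad pi) = h o pi. *)
Definition represents_mean_curvature n (M : charted_space R n)
    (g : tensor02 M) (pi : M -> R) (h : R -> R) : Prop :=
  forall (i : chart_index M) (p : M), dom i p ->
    divergence (g i) (gradient (g i) (local_fun pi i)) (coord i p) = h (pi p).

(* From here on Phi is an immersion read in coordinates and G the metric of the
   ambient space. *)
Definition induced_metric m n (G : 'rV[R]_n -> 'M[R]_n)
    (Phi : 'rV[R]_m -> 'rV[R]_n) (y : 'rV[R]_m) : 'M[R]_m :=
  jacobian Phi y *m G (Phi y) *m (jacobian Phi y)^T.

(* The component of w normal to the image of d Phi; see [normal_part_orth] and
   [normal_part_tangent]. *)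
Definition normal_part m n (G : 'rV[R]_n -> 'M[R]_n)
    (Phi : 'rV[R]_m -> 'rV[R]_n) (y : 'rV[R]_m) (w : 'rV[R]_n) : 'rV[R]_n :=
  let J := jacobian Phi y in
  w - w *m G (Phi y) *m J^T *m invmx (induced_metric G Phi y) *m J.

Lemma normal_part_orth m n (G : 'rV[R]_n -> 'M[R]_n)
    (Phi : 'rV[R]_m -> 'rV[R]_n) (y : 'rV[R]_m) (w : 'rV[R]_n) (v : 'rV[R]_m) :
  induced_metric G Phi y \in unitmx ->
  scalar_product (G (Phi y)) (normal_part G Phi y w) (v *m jacobian Phi y) = 0.
Proof.
move=> U; rewrite /scalar_product /normal_part trmx_mul !mulmxBl.
set J := jacobian Phi y; rewrite -!mulmxA.
rewrite [J *m (_ *m _)]mulmxA [J *m _ *m _]mulmxA -/(induced_metric G Phi y).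
by rewrite [invmx _ *m _]mulmxA mulVmx // mul1mx subrr mxE.
Qed.

Lemma normal_part_tangent m n (G : 'rV[R]_n -> 'M[R]_n)
    (Phi : 'rV[R]_m -> 'rV[R]_n) (y : 'rV[R]_m) (w : 'rV[R]_n) :
  exists v, w - normal_part G Phi y w = v *m jacobian Phi y.
Proof. by rewrite /normal_part subKr; eexists. Qed.

(* The derivative along Phi of the field d Phi (e_b) in the direction e_a, for
   the Levi-Civita connection of the ambient space. *)
Definition cov_derivative m n (G : 'rV[R]_n -> 'M[R]_n)
    (Phi : 'rV[R]_m -> 'rV[R]_n) (y : 'rV[R]_m) (a b : 'I_m) : 'rV[R]_n :=
  \row_c (pd a (fun z => jacobian Phi z b c) y
          + \sum_(d < n) \sum_(e < n)
              christoffel G (Phi y) c d e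
              * jacobian Phi y a d * jacobian Phi y b e).

Definition second_fundamental_form m n (G : 'rV[R]_n -> 'M[R]_n)
    (Phi : 'rV[R]_m -> 'rV[R]_n) (y : 'rV[R]_m) (a b : 'I_m) : 'rV[R]_n :=
  normal_part G Phi y (cov_derivative G Phi y a b).

Definition mean_curvature_vector m n (G : 'rV[R]_n -> 'M[R]_n)
    (Phi : 'rV[R]_m -> 'rV[R]_n) (y : 'rV[R]_m) : 'rV[R]_n :=
  \sum_(a < m) \sum_(b < m)
    invmx (induced_metric G Phi y) a b *: second_fundamental_form G Phi y a b.

Definition graph_map n (M : charted_space R n) (u : M -> R) :
    M -> prod_space M real_line :=
  fun x => (x, u x).

Definition nondegenerate_induced_metric m n (M : charted_space R m)
    (N : charted_space R n) (g : tensor02 N) (F : M -> N) : Prop :=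
  forall (i : chart_index M) (j : chart_index N) (p : M),
    dom i p -> dom j (F p) ->
    induced_metric (g j) (local_map F i j) (coord i p) \in unitmx.

(* Components of the coordinate field d/dt, the same in all charts of M x R. *)
Definition partial_t n : 'rV[R]_(n + 1) := row_mx 0 (const_mx 1).

Definition translating_soliton n (M : charted_space R n) (g : tensor02 M)
    (e : R) (F : M -> prod_space M real_line) : Prop :=
  forall (i : chart_index M) (j : chart_index (prod_space M real_line)) (p : M),
    dom i p -> dom j (F p) ->
    let G := product_metric g e j in
    let Phi := local_map F i j in
    mean_curvature_vector G Phi (coord i p)
      = normal_part G Phi (coord i p) (partial_t n).

Definition action_invariant k n (G : charted_space R k) (M : charted_space R n)
    (act : G -> M -> M) (u : M -> R) : Prop :=
  forall (x : M) (a : G), u (act a x) = u x.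

End Manifold.

(* Main.v *)
Require Import Defs.
From HB Require Import structures.
From mathcomp Require Import all_boot all_order all_algebra.
From mathcomp Require Import all_classical all_reals all_analysis.
From mathcomp Require Import ring lra.
Import Order.TTheory GRing.Theory Num.Theory.
Import numFieldNormedType.Exports.
Set Implicit Arguments.
Unset Strict Implicit.
Unset Printing Implicit Defensive.
Local Open Scope classical_set_scope.
Local Open Scope ring_scope.

(** Fix a chart, with metric G, and a function u.  The tangent space of the graph
of u is the row space of [1 | du], and the normal part of a vector vanishes
exactly when the vector is tangent.  The soliton equation therefore says that
the trace of the covariant derivatives of the frame, minus d/dt, is tangent
([mean_curvature_eq_normal_part]); no unit normal has to be chosen.  For the
product metric the component of this trace along d/dt is the trace of the
second derivatives of u and its other components are the traced Christoffel
symbols, so tangency is one scalar equation ([trace_cov_derivative_graph]):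
    tr_gamma (Hess u) = 1,   gamma = G + e du du^T the induced metric.

Let now u = f o pi, and let X be the gradient of pi.  A semi-Riemannian
submersion has g(X, X) = et: X is horizontal, so q := dpi(X) = g(X, X)
satisfies q = et q^2, and q = 0 is excluded by nondegeneracy and surjectivity
([submersion_gradient]).  Since the norm of X is constant, Hess pi (X, X) = 0
([hessian_gradient_gradient]), while the G-trace of Hess pi is div X = h o pi
([trace_hessian]).  The metric gamma is the rank one update
G + e f'^2 dpi dpi^T of G, hence with W = 1 + e et f'^2
    gamma^-1 = G^-1 - (e f'^2 / W) X^T X,
where W <> 0 because gamma is nondegenerate.  Substituting
Hess u = f'' dpi dpi + f' Hess pi, the scalar equation becomes
    f'' et / W + f' h = 1,
which is the differential equation because et^2 = 1
([graph_soliton_ode]).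

Two facts connect this computation with the manifold.  The soliton equation is
read in a chart i of the source and a possibly different chart of the target;
composing the graph with a change of coordinates changes the trace of the
covariant derivatives by a tangent vector only
([trace_cov_derivative_reparam]), so a single chart suffices.  An invariant u
is constant on the fibers of pi, which are orbits, hence u = f o pi for some
f.  Such an f is automatically C2: along a coordinate line on which pi has
nonzero derivative, pi is a local diffeomorphism rho of the line, and
f o rho = w gives f' o rho = w' / rho', and once more for the second derivative
([C2_at_factor]). *)

Local Notation coord := Defs.coord.

(** * Partial derivatives and Jacobians in coordinates *)

Section PartialDerivatives.
Context {R : realType}.

Lemma differentiable_near_eq (V W : normedModType R) (f g : V -> W) (x : V) :
  (\forall z \near x, f z = g z) -> differentiable f x -> differentiable g x.
Proof.
move=> fg df.
have fgx : f x = g x by exact: nbhs_singleton fg.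
have dfc : continuous ('d f x) by have [] := (diff_locallyP x f).1 df.
have gE : g \o shift x = cst (g x) + 'd f x +o_ 0 id.
  apply/eqaddoP => eps e0; have /eqaddoP/(_ eps e0) fE := diff_locally df.
  have fg0 : \forall h \near 0, f (h + x) = g (h + x).
    by move: fg; rewrite (near_shift 0 x) subr0.
  by apply: filterS2 fE fg0 => h; rewrite /= !fctE /= => + E; rewrite E fgx.
have dgf : 'd g x = 'd f x :> (V -> W) by apply: diff_unique.
by apply/diff_locallyP; rewrite dgf; split.
Qed.

Lemma differentiable_row (V : normedModType R) n (f : V -> 'rV[R]_n) (x : V) :
  (forall c, differentiable (fun z => f z ord0 c : R) x) -> differentiable f x.
Proof.
move=> df.
rewrite (_ : f = \sum_(c < n) (fun z => f z ord0 c *: delta_mx ord0 c)).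
  apply: differentiable_sum => c.
  by apply: (@differentiableZl _ _ _ (fun z => f z ord0 c) (delta_mx ord0 c)).
by apply/funext => z; rewrite fct_sumE [LHS]row_sum_delta.
Qed.

Lemma differentiable_entry (V : normedModType R) m n (f : V -> 'M[R]_(m, n))
    (x : V) i j :
  differentiable f x -> differentiable (fun z => f z i j : R) x.
Proof.
move=> df.
exact: (@differentiable_comp _ _ _ _ f (fun N : 'M[R]_(m, n) => N i j) _ df
  (differentiable_coord _ _ _)).
Qed.

Lemma derive_entry (V : normedModType R) n (f : V -> 'rV[R]_n) (x v : V) c :
  differentiable f x -> 'D_v f x ord0 c = 'D_v (fun z => f z ord0 c : R) x.
Proof.
by move=> df; rewrite derive_mx ?mxE //; apply: diff_derivable.
Qed.

Lemma derive_pd n (f : 'rV[R]_n -> R) y v :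
  differentiable f y -> 'D_v f y = \sum_(a < n) v ord0 a * pd a f y.
Proof.
move=> df; rewrite deriveE // [v in LHS]row_sum_delta linear_sum /=.
by apply: eq_bigr => a _; rewrite linearZ /= /pd deriveE.
Qed.

Lemma jacobianE m n (f : 'rV[R]_m -> 'rV[R]_n) y a c :
  differentiable f y -> jacobian f y a c = pd a (fun z => f z ord0 c) y.
Proof.
move=> df; rewrite /pd -derive_entry // deriveEjacobian //.
by rewrite -rowE [RHS]mxE.
Qed.

Lemma jacobian_comp l m n (f : 'rV[R]_l -> 'rV[R]_m) (g : 'rV[R]_m -> 'rV[R]_n)
    y :
  differentiable f y -> differentiable g (f y) ->
  jacobian (g \o f) y = jacobian f y *m jacobian g (f y).
Proof.
move=> df dg; apply/row_matrixP => a; rewrite rowE.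
rewrite -deriveEjacobian; last exact: differentiable_comp.
rewrite deriveE; last exact: differentiable_comp.
rewrite diff_comp //= -deriveE // -deriveE // !deriveEjacobian //.
by rewrite rowE mulmxA.
Qed.

Lemma jacobian_near_eq m n (f g : 'rV[R]_m -> 'rV[R]_n) y :
  differentiable f y -> differentiable g y ->
  (\forall z \near y, f z = g z) -> jacobian f y = jacobian g y.
Proof.
move=> df dg fg; apply/matrixP => a c.
apply: etrans (jacobianE a c df) _; apply: esym.
apply: etrans (jacobianE a c dg) _; apply: esym.
have fgc : \forall z \near y, f z ord0 c = g z ord0 c.
  by apply: filterS fg => z ->.
exact: near_eq_derive fgc.
Qed.

Lemma pd_near_eq n (a : 'I_n) (f g : 'rV[R]_n -> R) y :
  (\forall z \near y, f z = g z) -> pd a f y = pd a g y.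
Proof. exact: near_eq_derive. Qed.

Lemma pd_cst n (a : 'I_n) (c : R) y : pd a (fun=> c) y = 0.
Proof. exact: derive_cst. Qed.

Lemma pdD n (a : 'I_n) (f g : 'rV[R]_n -> R) y :
  differentiable f y -> differentiable g y ->
  pd a (fun z => f z + g z) y = pd a f y + pd a g y.
Proof. by move=> df dg; apply: deriveD; apply: diff_derivable. Qed.

Lemma pdM n (a : 'I_n) (f g : 'rV[R]_n -> R) y :
  differentiable f y -> differentiable g y ->
  pd a (fun z => f z * g z) y = pd a f y * g y + f y * pd a g y.
Proof.
move=> df dg; rewrite /pd (@deriveM _ _ f g); try exact: diff_derivable.
by rewrite addrC /GRing.scale /=; congr (_ + _); rewrite mulrC.
Qed.

Lemma differentiable_bigsum (V : normedModType R) (I : Type) (r : seq I)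
    (P : pred I) (F : I -> V -> R) x :
  (forall i, differentiable (F i) x) ->
  differentiable (fun z => \sum_(i <- r | P i) F i z) x.
Proof.
move=> dF; elim: r => [|i r IH].
  by under eq_fun do rewrite big_nil; apply: differentiable_cst.
under eq_fun do rewrite big_cons.
by case: (P i) => //; apply: (@differentiableD _ _ _ (F i)).
Qed.

Lemma differentiable_bigprod (V : normedModType R) (I : Type) (r : seq I)
    (F : I -> V -> R) x :
  (forall i, differentiable (F i) x) ->
  differentiable (fun z => \prod_(i <- r) F i z) x.
Proof.
move=> dF; elim: r => [|i r IH].
  by under eq_fun do rewrite big_nil; apply: differentiable_cst.
under eq_fun do rewrite big_cons.
exact: (@differentiableM _ _ (F i)).
Qed.

Lemma pd_sum n (a : 'I_n) (I : Type) (r : seq I)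
    (F : I -> 'rV[R]_n -> R) y :
  (forall i, differentiable (F i) y) ->
  pd a (fun z => \sum_(i <- r) F i z) y = \sum_(i <- r) pd a (F i) y.
Proof.
move=> dF; elim: r => [|i r IH].
  by under eq_fun do rewrite big_nil; rewrite pd_cst big_nil.
under eq_fun do rewrite big_cons.
by rewrite pdD ?IH ?big_cons //; apply: differentiable_bigsum.
Qed.

Lemma pd_comp l m (a : 'I_l) (f : 'rV[R]_m -> R) (tau : 'rV[R]_l -> 'rV[R]_m)
    y :
  differentiable tau y -> differentiable f (tau y) ->
  pd a (fun z => f (tau z)) y
    = \sum_(c < m) jacobian tau y a c * pd c f (tau y).
Proof.
move=> dt df; rewrite /pd deriveE; last exact: (@differentiable_comp _ _ _ _ tau f).
rewrite (diff_comp dt df) /= -!deriveE // derive_pd //.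
by apply: eq_bigr => c _; rewrite derive_entry // jacobianE.
Qed.

Lemma pd_comp1 n (a : 'I_n) (f : R -> R) (p : 'rV[R]_n -> R) y :
  differentiable p y -> derivable f (p y) 1 ->
  pd a (fun z => f (p z)) y = derive1 f (p y) * pd a p y.
Proof.
move=> dp /derivable1_diffP df.
rewrite /pd deriveE; last exact: (@differentiable_comp _ _ _ _ p f).
have lin (t : R) : 'd f (p y) t = 'd f (p y) 1 * t.
  by rewrite -[t in LHS]mulr1 [LHS]linearZ mulrC.
by rewrite (diff_comp dp df) /= lin derive1E' // deriveE.
Qed.

Lemma differentiable_det (V : normedModType R) n (A : V -> 'M[R]_n) x :
  (forall i j, differentiable (fun z => A z i j : R) x) ->
  differentiable (fun z => \det (A z)) x.
Proof.
move=> dA; rewrite /determinant; apply: differentiable_bigsum => s.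
apply: differentiableM; first exact: differentiable_cst.
by apply: differentiable_bigprod => i.
Qed.

(** Cramer's formula, valid where the matrix is invertible, is polynomial in the
    entries up to the inverse of the determinant. *)
Lemma differentiable_invmx (V : normedModType R) n (A : V -> 'M[R]_n) x i j :
  (forall i j, differentiable (fun z => A z i j : R) x) ->
  (\forall z \near x, A z \in unitmx) ->
  differentiable (fun z => invmx (A z) i j : R) x.
Proof.
move=> dA uA.
apply: (@differentiable_near_eq _ _ (fun z => (\det (A z))^-1 * \adj (A z) i j)).
  by apply: filterS uA => z uz; rewrite /invmx uz !mxE.
apply: differentiableM.
  apply: differentiableV; first exact: differentiable_det.
  by have := nbhs_singleton uA; rewrite /= unitmxE unitfE.
under eq_fun do rewrite mxE /cofactor.
apply: differentiableM; first exact: differentiable_cst.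
apply: differentiable_det => k l.
by under eq_fun do rewrite !mxE; apply: dA.
Qed.

End PartialDerivatives.

(** * The soliton equation modulo tangent vectors, and change of parameters *)

Section NormalPart.
Context {R : realType}.

Lemma mxtrace_mul_tr m n (A B : 'M[R]_(m, n)) :
  \tr (A *m B^T) = \sum_a \sum_b A a b * B a b.
Proof.
by apply: eq_bigr => a _; rewrite mxE; apply: eq_bigr => b _; rewrite mxE.
Qed.

Lemma invmx_uniq n (A B : 'M[R]_n) : A *m B = 1%:M -> invmx A = B.
Proof.
by move=> AB1; rewrite -[RHS](mulKmx (proj1 (mulmx1_unit AB1))) AB1 mulmx1.
Qed.

Lemma normal_part_mulmx m n (G : 'rV[R]_n -> 'M[R]_n)
    (Phi : 'rV[R]_m -> 'rV[R]_n) (y : 'rV[R]_m) (w : 'rV[R]_n) :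
  normal_part G Phi y w
    = w *m (1%:M - G (Phi y) *m (jacobian Phi y)^T
                   *m invmx (induced_metric G Phi y) *m jacobian Phi y).
Proof. by rewrite /normal_part mulmxBr mulmx1 !mulmxA. Qed.

(** The normal part is the projection along the image of d Phi, so its kernel is
    that image. *)
Lemma normal_part_eq0 m n (G : 'rV[R]_n -> 'M[R]_n)
    (Phi : 'rV[R]_m -> 'rV[R]_n) (y : 'rV[R]_m) (w : 'rV[R]_n) :
  induced_metric G Phi y \in unitmx ->
  normal_part G Phi y w = 0 <-> exists v, w = v *m jacobian Phi y.
Proof.
move=> U; split=> [w0 | [v ->]].
  have [v] := normal_part_tangent G Phi y w.
  by rewrite w0 subr0 => ->; exists v.
have -> : normal_part G Phi y (v *m jacobian Phi y)
    = v *m jacobian Phi y - v *m induced_metric G Phi y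
        *m invmx (induced_metric G Phi y) *m jacobian Phi y.
  by rewrite /normal_part /induced_metric !mulmxA.
by rewrite mulmxK // subrr.
Qed.

(** The mean curvature vector before its tangential component is removed.  It
    still depends on the parametrization, but only through a tangent vector. *)
Definition trace_cov_derivative m n (G : 'rV[R]_n -> 'M[R]_n)
    (Phi : 'rV[R]_m -> 'rV[R]_n) (y : 'rV[R]_m) : 'rV[R]_n :=
  \sum_(a < m) \sum_(b < m)
    invmx (induced_metric G Phi y) a b *: cov_derivative G Phi y a b.

(** Both sides are normal parts, and taking the normal part is linear with the
    tangent vectors as kernel. *)
Lemma mean_curvature_eq_normal_part m n (G : 'rV[R]_n -> 'M[R]_n)
    (Phi : 'rV[R]_m -> 'rV[R]_n) (y : 'rV[R]_m) (w : 'rV[R]_n) :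
  induced_metric G Phi y \in unitmx ->
  mean_curvature_vector G Phi y = normal_part G Phi y w <->
  exists v, trace_cov_derivative G Phi y - w = v *m jacobian Phi y.
Proof.
move=> U; rewrite -(normal_part_eq0 _ U).
have -> : mean_curvature_vector G Phi y
    = normal_part G Phi y (trace_cov_derivative G Phi y).
  rewrite [RHS]normal_part_mulmx mulmx_suml; apply: eq_bigr => a _.
  rewrite mulmx_suml; apply: eq_bigr => b _.
  by rewrite -scalemxAl -normal_part_mulmx.
rewrite !normal_part_mulmx mulmxBl; split=> [-> | /eqP]; first exact: subrr.
by rewrite subr_eq0 => /eqP.
Qed.

(** One matrix for each upper index: the quadratic term of the covariant derivative
    becomes a congruence by the Jacobian. *)
Definition christoffel_mx n (G : 'rV[R]_n -> 'M[R]_n) (y : 'rV[R]_n)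
    (c : 'I_n) : 'M[R]_n :=
  \matrix_(a, b) christoffel G y c a b.

Lemma cov_derivativeE m n (G : 'rV[R]_n -> 'M[R]_n)
    (Phi : 'rV[R]_m -> 'rV[R]_n) (y : 'rV[R]_m) a b c :
  cov_derivative G Phi y a b ord0 c
    = pd a (fun z => jacobian Phi z b c) y
      + (jacobian Phi y *m christoffel_mx G (Phi y) c
           *m (jacobian Phi y)^T) a b.
Proof.
rewrite mxE; congr (_ + _); rewrite [RHS]mxE exchange_big /=.
apply: eq_bigr => e _; rewrite [(_ *m _) a e]mxE [_^T e b]mxE big_distrl /=.
apply: eq_bigr => d _; rewrite [christoffel_mx _ _ _ _ _]mxE.
by congr (_ * _); apply: mulrC.
Qed.

Lemma trace_cov_derivativeE m n (G : 'rV[R]_n -> 'M[R]_n)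
    (Phi : 'rV[R]_m -> 'rV[R]_n) (y : 'rV[R]_m) (A : 'M[R]_m) c :
  invmx (induced_metric G Phi y) = A ->
  trace_cov_derivative G Phi y ord0 c
    = \sum_(a < m) \sum_(b < m) A a b * cov_derivative G Phi y a b ord0 c.
Proof.
move=> <-; rewrite summxE; apply: eq_bigr => a _; rewrite summxE.
by apply: eq_bigr => b _; rewrite [LHS]mxE.
Qed.

(** With J the Jacobian of tau, the covariant derivatives transform as a bilinear
    form under J, plus the second derivatives of tau, which only contribute
    tangent vectors.  The inverse of the induced metric transforms contragrediently,
    so the traces agree up to a tangent vector.  That J is invertible follows from
    the nondegeneracy of the metric induced by Phi. *)
Lemma trace_cov_derivative_reparam m n (G : 'rV[R]_n -> 'M[R]_n)
    (Phi Psi : 'rV[R]_m -> 'rV[R]_n) (tau : 'rV[R]_m -> 'rV[R]_m)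
    (y : 'rV[R]_m) :
  (\forall z \near y, Phi z = Psi (tau z)) ->
  (\forall z \near y, differentiable tau z) ->
  (\forall z \near y, differentiable Psi (tau z)) ->
  (forall a b, differentiable (fun z => jacobian tau z a b : R) y) ->
  (forall a b, differentiable (fun x => jacobian Psi x a b : R) (tau y)) ->
  induced_metric G Phi y \in unitmx ->
  induced_metric G Psi (tau y) \in unitmx /\
  forall w,
    (exists v, trace_cov_derivative G Phi y - w = v *m jacobian Phi y) <->
    (exists v, trace_cov_derivative G Psi (tau y) - w
                 = v *m jacobian Psi (tau y)).
Proof.
move=> PhiE dtau dPsi ddtau ddPsi U.
have dty := nbhs_singleton dtau.
have Phiy := nbhs_singleton PhiE.
set J := jacobian tau y; set K := jacobian Psi (tau y).
have JPhi : \forall z \near y,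
    jacobian Phi z = jacobian tau z *m jacobian Psi (tau z).
  move: (near_join PhiE) => PhiE2; near=> z.
  have dtz : differentiable tau z by near: z.
  have dPz : differentiable Psi (tau z) by near: z.
  have PhizE : \forall x \near z, Phi x = Psi (tau x) by near: z.
  have dc : differentiable (Psi \o tau) z by apply: differentiable_comp.
  have dPhi : differentiable Phi z.
    by apply: differentiable_near_eq dc; apply: filterS PhizE => x ->.
  rewrite -(jacobian_comp dtz dPz).
  exact: (jacobian_near_eq dPhi dc).
have JPhiy : jacobian Phi y = J *m K := nbhs_singleton JPhi.
have metE : induced_metric G Phi y = J *m induced_metric G Psi (tau y) *m J^T.
  by rewrite /induced_metric Phiy JPhiy trmx_mul !mulmxA.
have [uJ uM] : J \in unitmx /\ induced_metric G Psi (tau y) \in unitmx.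
  by move: U; rewrite metE !unitmx_mul => /andP[/andP[-> ->]].
split; first exact: uM.
set A := invmx (induced_metric G Phi y).
have AE : J^T *m A *m J = invmx (induced_metric G Psi (tau y)).
  apply/esym/invmx_uniq; have AK := mulmxV U.
  rewrite -(mulKmx uJ (_ *m (J^T *m A *m J))).
  have -> : J *m (induced_metric G Psi (tau y) *m (J^T *m A *m J)) = J.
    by rewrite -[RHS]mul1mx -AK {1}metE !mulmxA.
  exact: mulVmx.
(* The coefficients of the tangent vector by which the two traces differ. *)
pose v0 := \row_d \sum_a \sum_b A a b * pd a (fun z => jacobian tau z b d) y.
suff trE : trace_cov_derivative G Phi y
    = trace_cov_derivative G Psi (tau y) + v0 *m K.
  move=> w; rewrite JPhiy trE addrAC; split=> -[v E].
    by exists (v *m J - v0); rewrite mulmxBl -mulmxA -E addrK.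
  by exists ((v + v0) *m invmx J); rewrite mulmxA mulmxKV // mulmxDl E.
apply/rowP => c.
have covE a b : cov_derivative G Phi y a b ord0 c
  = \sum_d pd a (fun z => jacobian tau z b d) y * K d c
    + (J *m (\matrix_(d, e) cov_derivative G Psi (tau y) d e ord0 c) *m J^T) a b.
  rewrite cov_derivativeE.
  have -> : \matrix_(d, e) cov_derivative G Psi (tau y) d e ord0 c
     = \matrix_(d, e) pd d (fun x => jacobian Psi x e c) (tau y)
       + K *m christoffel_mx G (Psi (tau y)) c *m K^T.
    apply/matrixP => d e; rewrite [LHS]mxE cov_derivativeE [RHS]mxE.
    by congr (_ + _); rewrite [RHS]mxE.
  rewrite mulmxDr mulmxDl [X in _ = _ + X]mxE addrA Phiy JPhiy trmx_mul !mulmxA.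
  congr (_ + _).
  rewrite (@pd_near_eq _ _ _ _
     (fun z => \sum_d jacobian tau z b d * jacobian Psi (tau z) d c)); last first.
    by apply: filterS JPhi => z ->; rewrite mxE.
  have dK d : differentiable (fun z => jacobian Psi (tau z) d c : R) y.
    exact: (@differentiable_comp _ _ _ _ tau (fun x => jacobian Psi x d c)
      _ dty (ddPsi d c)).
  rewrite pd_sum => [|d]; last exact: (differentiableM (ddtau b d) (dK d)).
  under eq_bigr => d _.
    rewrite (pdM a (ddtau b d) (dK d)) (pd_comp a dty (ddPsi d c)).
    over.
  rewrite big_split /=; congr (_ + _).
  rewrite [RHS]mxE; apply: eq_bigr => d _.
  rewrite [J^T d b]mxE mulrC [(J *m _) a d]mxE; congr (_ * _).
  by apply: eq_bigr => e _; congr (_ * _); rewrite [RHS]mxE.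
pose X1 := \sum_a \sum_b A a b * (J *m (\matrix_(d, e)
        cov_derivative G Psi (tau y) d e ord0 c) *m J^T) a b.
pose X2 := \sum_a \sum_b A a b *
        (\sum_d pd a (fun z => jacobian tau z b d) y * K d c).
have S1 : \sum_a \sum_b A a b * cov_derivative G Phi y a b ord0 c = X1 + X2.
  rewrite /X1 /X2 -big_split; apply: eq_bigr => a _ /=.
  rewrite -big_split; apply: eq_bigr => b _ /=.
  by rewrite covE mulrDr addrC.
have S2 : X1 = trace_cov_derivative G Psi (tau y) ord0 c.
  apply/esym; apply: etrans (trace_cov_derivativeE c (esym AE)) _; apply/esym.
  rewrite /X1 -mxtrace_mul_tr !trmx_mul trmxK !mulmxA mxtrace_mulC !mulmxA.
  rewrite mxtrace_mul_tr; apply: eq_bigr => a _; apply: eq_bigr => b _.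
  by congr (_ * _); rewrite mxE.
(* The contribution of the second derivatives of tau: a combination of the rows
   of K, that is, a tangent vector. *)
have S3 : X2 = \sum_d \sum_a \sum_b
   A a b * (pd a (fun z => jacobian tau z b d) y * K d c).
  apply/esym; rewrite exchange_big; apply: eq_bigr => a _.
  by rewrite exchange_big; apply: eq_bigr => b _; rewrite big_distrr.
apply: etrans (trace_cov_derivativeE c (erefl A)) _.
apply: etrans S1 _; apply/esym; apply: etrans (mxE _ _ _ _) _.
apply/esym; congr (_ + _) => //; apply/esym; apply: etrans (mxE _ _ _ _) _.
apply: etrans (esym S3); apply: eq_bigr => d _.
rewrite [X in X * _]mxE big_distrl; apply: eq_bigr => a _.
by rewrite big_distrl; apply: eq_bigr => b _; rewrite /= mulrA.
Unshelve. all: by end_near. Qed.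

End NormalPart.

(** * Graphs in a product metric *)

Section Graph.
Context {R : realType}.

Definition differential n (f : 'rV[R]_n -> R) (y : 'rV[R]_n) : 'rV[R]_n :=
  \row_a pd a f y.

Definition hessian n (G : 'rV[R]_n -> 'M[R]_n) (f : 'rV[R]_n -> R)
    (y : 'rV[R]_n) (a b : 'I_n) : R :=
  pd a (pd b f) y - \sum_c christoffel G y c a b * pd c f y.

Definition graph_in_chart n (u : 'rV[R]_n -> R) (z : 'rV[R]_n) :
    'rV[R]_(n + 1) :=
  row_mx z (const_mx (u z)).

Definition product_gram n (G : 'rV[R]_n -> 'M[R]_n) (e : R)
    (x : 'rV[R]_(n + 1)) : 'M[R]_(n + 1) :=
  block_mx (G (lsubmx x)) 0 0 e%:M.

Lemma graph_in_chartL n (u : 'rV[R]_n -> R) z (c : 'I_n) :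
  graph_in_chart u z ord0 (lshift 1 c) = z ord0 c.
Proof. exact: row_mxEl. Qed.

Lemma graph_in_chartR n (u : 'rV[R]_n -> R) z (c : 'I_1) :
  graph_in_chart u z ord0 (rshift n c) = u z.
Proof. by apply: etrans (row_mxEr _ _ _ _) _; rewrite mxE. Qed.

Lemma differentiable_graph_in_chart n (u : 'rV[R]_n -> R) y :
  differentiable u y -> differentiable (graph_in_chart u) y.
Proof.
move=> du; apply: differentiable_row => c.
rewrite -(splitK c); case: (fintype.split c) => c' /=.
  have -> : (fun z => graph_in_chart u z ord0 (lshift 1 c'))
    = (fun z => z ord0 c') by apply/funext => z; exact: graph_in_chartL.
  exact: differentiable_coord.
have -> : (fun z => graph_in_chart u z ord0 (rshift n c')) = u.
  by apply/funext => z; exact: graph_in_chartR.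
exact: du.
Qed.

Lemma pd_coord n (a c : 'I_n) (y : 'rV[R]_n) :
  pd a (fun z : 'rV[R]_n => z ord0 c) y = (a == c)%:R.
Proof.
rewrite /pd -(@derive_entry _ _ _ id) //.
by rewrite derive_id mxE eqxx eq_sym.
Qed.

Lemma jacobian_graph n (u : 'rV[R]_n -> R) y :
  differentiable u y ->
  jacobian (graph_in_chart u) y = row_mx 1%:M (differential u y)^T.
Proof.
move=> du; apply/matrixP => a c.
apply: etrans (jacobianE a c (differentiable_graph_in_chart du)) _.
rewrite -(splitK c); case: (fintype.split c) => c' /=.
  rewrite row_mxEl mxE -(pd_coord a c' y); congr (pd a _ y).
  by apply/funext => z; exact: graph_in_chartL.
rewrite row_mxEr !mxE; congr (pd a _ y).
by apply/funext => z; exact: graph_in_chartR.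
Qed.

Lemma differentiable_jacobian_graph n (u : 'rV[R]_n -> R) y a c :
  (\forall z \near y, differentiable u z) ->
  (forall b, differentiable (pd b u) y) ->
  differentiable (fun z => jacobian (graph_in_chart u) z a c : R) y.
Proof.
move=> du ddu.
apply: (@differentiable_near_eq _ _ _
  (fun z => (row_mx 1%:M (differential u z)^T : 'M[R]_(n, n + 1)) a c : R)).
  by apply: filterS du => z dz; rewrite jacobian_graph.
rewrite -(splitK c); case: (fintype.split c) => c' /=.
  by under eq_fun do rewrite row_mxEl; exact: differentiable_cst.
have -> : (fun z => (row_mx 1%:M (differential u z)^T : 'M[R]_(n, n + 1))
    a (rshift n c')) = pd a u.
  by apply/funext => z; rewrite row_mxEr !mxE.
exact: ddu.
Qed.

Lemma lsubmx_graph n (u : 'rV[R]_n -> R) y : lsubmx (graph_in_chart u y) = y.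
Proof. exact: row_mxKl. Qed.

Lemma induced_metric_graph n (G : 'rV[R]_n -> 'M[R]_n) (e : R)
    (u : 'rV[R]_n -> R) y :
  differentiable u y ->
  induced_metric (product_gram G e) (graph_in_chart u) y
    = G y + e *: ((differential u y)^T *m differential u y).
Proof.
move=> du; rewrite /induced_metric jacobian_graph // /product_gram lsubmx_graph.
rewrite mul_row_block tr_row_mx mul_row_col trmx1 trmxK !mulmx0 !mulmx1 mul1mx.
by rewrite addr0 add0r mul_mx_scalar -scalemxAl.
Qed.

Lemma derive_lsubmx m n (F : 'rV[R]_m -> R) (x v : 'rV[R]_(m + n)) :
  'D_v (fun z : 'rV[R]_(m + n) => F (lsubmx z)) x = 'D_(lsubmx v) F (lsubmx x).
Proof.
rewrite /derive; set d := (fun _ : R => _); set d' := (fun _ : R => _).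
suff -> : d = d' by []; apply/funext => h; rewrite /d /d' /=.
by congr (_ *: (F _ - _)); apply/rowP => b; rewrite !mxE.
Qed.

Lemma pd_lsubmx_l m n (F : 'rV[R]_m -> R) (x : 'rV[R]_(m + n)) a :
  pd (lshift n a) (fun z : 'rV[R]_(m + n) => F (lsubmx z)) x
    = pd a F (lsubmx x).
Proof.
rewrite /pd derive_lsubmx; congr ('D_ _ F _); apply/rowP => b.
by rewrite !mxE eq_lshift.
Qed.

Lemma pd_lsubmx_r m n (F : 'rV[R]_m -> R) (x : 'rV[R]_(m + n)) a :
  pd (rshift m a) (fun z : 'rV[R]_(m + n) => F (lsubmx z)) x = 0.
Proof.
rewrite /pd derive_lsubmx.
have -> : lsubmx (delta_mx ord0 (rshift m a)) = 0 :> 'rV[R]_m.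
  by apply/rowP => b; rewrite !mxE eq_lrshift.
exact: derive0.
Qed.

Section Product.
Variables (n : nat) (G : 'rV[R]_n -> 'M[R]_n) (e : R).

Let Gt_ul b c : (fun x => product_gram G e x (lshift 1 b) (lshift 1 c))
  = (fun x => G (lsubmx x) b c).
Proof. by apply/funext => x; rewrite /product_gram block_mxEul. Qed.

Let Gt_ur b c : (fun x => product_gram G e x (lshift 1 b) (rshift n c))
  = (fun=> 0).
Proof. by apply/funext => x; rewrite /product_gram block_mxEur mxE. Qed.

Let Gt_dl b c : (fun x => product_gram G e x (rshift n b) (lshift 1 c))
  = (fun=> 0).
Proof. by apply/funext => x; rewrite /product_gram block_mxEdl mxE. Qed.

Let Gt_dr b c : (fun x => product_gram G e x (rshift n b) (rshift n c))
  = (fun=> (e%:M : 'M[R]_1) b c).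
Proof. by apply/funext => x; rewrite /product_gram block_mxEdr. Qed.

Lemma pd_product_gram_t a b c x :
  pd (rshift n a) (fun z => product_gram G e z b c) x = 0.
Proof.
rewrite -(splitK b) -(splitK c).
case: (fintype.split b) => b'; case: (fintype.split c) => c' /=.
- by rewrite Gt_ul (@pd_lsubmx_r _ _ (fun y => G y b' c')).
- by rewrite Gt_ur pd_cst.
- by rewrite Gt_dl pd_cst.
- by rewrite Gt_dr pd_cst.
Qed.

Lemma pd_product_gram_r a b c x :
  pd a (fun z => product_gram G e z b (rshift n c)) x = 0.
Proof.
rewrite -(splitK b); case: (fintype.split b) => b' /=.
- by rewrite Gt_ur pd_cst.
- by rewrite Gt_dr pd_cst.
Qed.

Lemma pd_product_gram_l a b c x :
  pd a (fun z => product_gram G e z (rshift n b) c) x = 0.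
Proof.
rewrite -(splitK c); case: (fintype.split c) => c' /=.
- by rewrite Gt_dl pd_cst.
- by rewrite Gt_dr pd_cst.
Qed.

Lemma pd_product_gram_ul a b c x :
  pd (lshift 1 a) (fun z => product_gram G e z (lshift 1 b) (lshift 1 c)) x
    = pd a (fun z => G z b c) (lsubmx x).
Proof. by rewrite Gt_ul (@pd_lsubmx_l _ _ (fun y => G y b c)). Qed.

(** Nothing depends on t and the metric is block diagonal with a constant last
    block, so the only Christoffel symbols left are those of G. *)
Lemma christoffel_product x :
  G (lsubmx x) \in unitmx -> e != 0 ->
  (forall c, christoffel_mx (product_gram G e) x (lshift 1 c)
     = block_mx (christoffel_mx G (lsubmx x) c) 0 0 0) /\
  (forall c, christoffel_mx (product_gram G e) x (rshift n c) = 0).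
Proof.
move=> uG e0.
have ue : (e%:M : 'M[R]_1) \in unitmx by rewrite unitmxE det_scalar1 unitfE.
have uGt : product_gram G e x \in unitmx.
  by rewrite /product_gram unitmxE det_ublock unitrM -!unitmxE uG ue.
have invE : invmx (product_gram G e x)
    = block_mx (invmx (G (lsubmx x))) 0 0 (invmx e%:M).
  exact: invmx_block_diag.
split=> c; apply/matrixP => a b; rewrite mxE /christoffel invE big_split_ord /=.
  rewrite [X in _ * (_ + X)]big1 ?addr0 => [|l _]; last first.
    by rewrite block_mxEur mxE mul0r.
  rewrite -(splitK a) -(splitK b).
  case: (fintype.split a) => a'; case: (fintype.split b) => b' /=.
  - rewrite block_mxEul mxE /christoffel; congr (_ * _); apply: eq_bigr => l _.
    by rewrite block_mxEul !pd_product_gram_ul.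
  - rewrite block_mxEur mxE big1 ?mulr0 // => l _.
    rewrite pd_product_gram_l pd_product_gram_t pd_product_gram_r.
    by rewrite !addr0 subr0 mulr0.
  - rewrite block_mxEdl mxE big1 ?mulr0 // => l _.
    by rewrite pd_product_gram_t !pd_product_gram_l !addr0 subr0 mulr0.
  - rewrite block_mxEdr mxE big1 ?mulr0 // => l _.
    by rewrite !pd_product_gram_l !addr0 subr0 mulr0.
rewrite mxE [X in _ * (X + _)]big1 ?add0r => [|l _]; last first.
  by rewrite block_mxEdl mxE mul0r.
rewrite big1 ?mulr0 // => l _.
by rewrite !pd_product_gram_r pd_product_gram_t addr0 subr0 mulr0.
Qed.

End Product.

(** The trace is [Z | t], with Z the traced Christoffel symbols and t the traced
    second derivatives of u; a vector [Z | r] is tangent to the graph exactly when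
    r = Z du^T. *)
Lemma trace_cov_derivative_graph n (G : 'rV[R]_n -> 'M[R]_n) (e : R)
    (u : 'rV[R]_n -> R) (y : 'rV[R]_n) (A : 'M[R]_n) :
  (\forall z \near y, differentiable u z) ->
  G y \in unitmx -> e != 0 ->
  invmx (induced_metric (product_gram G e) (graph_in_chart u) y) = A ->
  (exists v, trace_cov_derivative (product_gram G e) (graph_in_chart u) y
     - partial_t n = v *m jacobian (graph_in_chart u) y) <->
  \sum_a \sum_b A a b * hessian G u y a b = 1.
Proof.
move=> du uG e0 AE.
have duy := nbhs_singleton du.
have JE : \forall z \near y, jacobian (graph_in_chart u) z
    = row_mx 1%:M (differential u z)^T.
  by apply: filterS du => z; exact: jacobian_graph.
have uG' : G (lsubmx (graph_in_chart u y)) \in unitmx by rewrite lsubmx_graph.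
have [chrl chrr] := christoffel_product uG' e0.
have covl a b c : cov_derivative (product_gram G e) (graph_in_chart u) y a b
    ord0 (lshift 1 c) = christoffel G y c a b.
  rewrite cov_derivativeE chrl (nbhs_singleton JE).
  rewrite (@pd_near_eq _ _ _ _ (fun=> (1%:M : 'M[R]_n) b c)); last first.
    by apply: filterS JE => z ->; rewrite row_mxEl.
  rewrite pd_cst add0r lsubmx_graph tr_row_mx mul_row_block mul_row_col.
  by rewrite trmx1 !mulmx0 !addr0 mul0mx addr0 mul1mx mulmx1 mxE.
have covr a b c : cov_derivative (product_gram G e) (graph_in_chart u) y a b
    ord0 (rshift n c) = pd a (pd b u) y.
  rewrite cov_derivativeE chrr mulmx0 mul0mx [X in _ + X]mxE addr0.
  apply: pd_near_eq; apply: filterS JE => z ->.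
  by rewrite row_mxEr !mxE.
pose Z : 'rV[R]_n := \row_c \sum_a \sum_b A a b * christoffel G y c a b.
pose t := \sum_a \sum_b A a b * pd a (pd b u) y.
have trE : trace_cov_derivative (product_gram G e) (graph_in_chart u) y
    = row_mx Z (const_mx t).
  apply/rowP => c; apply: etrans (trace_cov_derivativeE c AE) _.
  rewrite -(splitK c); case: (fintype.split c) => c' /=.
    rewrite row_mxEl mxE; apply: eq_bigr => a _; apply: eq_bigr => b _.
    by rewrite covl.
  rewrite row_mxEr mxE; apply: eq_bigr => a _; apply: eq_bigr => b _.
  by rewrite covr.
have hessE : \sum_a \sum_b A a b * hessian G u y a b
    = t - (Z *m (differential u y)^T) ord0 ord0.
  have -> : (Z *m (differential u y)^T) ord0 ord0
      = \sum_a \sum_b A a b * \sum_c christoffel G y c a b * pd c u y.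
    rewrite mxE.
    under eq_bigr => c _ do rewrite !mxE big_distrl /=.
    rewrite exchange_big; apply: eq_bigr => a _ /=.
    under eq_bigr => c _ do rewrite big_distrl /=.
    rewrite exchange_big; apply: eq_bigr => b _ /=.
    by rewrite big_distrr; apply: eq_bigr => c _; rewrite /= mulrA.
  rewrite /t -sumrB; apply: eq_bigr => a _; rewrite -sumrB.
  by apply: eq_bigr => b _; rewrite -mulrBr.
rewrite trE hessE (nbhs_singleton JE) /partial_t opp_row_mx add_row_mx subr0.
split=> [[v]|E].
  rewrite mul_mx_row mulmx1 => /eq_row_mx[<- /rowP/(_ ord0)].
  by rewrite !mxE => <-; rewrite opprB addrC subrK.
exists Z; rewrite mul_mx_row mulmx1; congr row_mx.
apply/rowP => c; rewrite (ord1 c) [LHS]mxE.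
have -> : (const_mx t : 'rV[R]_1) ord0 ord0 = t by rewrite mxE.
have -> : (- const_mx 1 : 'rV[R]_1) ord0 ord0 = - 1 by rewrite !mxE.
by rewrite -E opprB addrC subrK.
Qed.

End Graph.

(** * Index contractions *)

Section Contractions.
Context {R : realType} (n : nat).
Implicit Types (A : 'I_n -> 'I_n -> R) (X : 'I_n -> R).

Let contr A X (F : 'I_n -> 'I_n -> 'I_n -> R) : R :=
  \sum_a \sum_b \sum_c A a b * X c * F a b c.

Let contrD A X F F' :
  contr A X (fun a b c => F a b c + F' a b c) = contr A X F + contr A X F'.
Proof.
rewrite /contr -big_split; apply: eq_bigr => a _ /=.
rewrite -big_split; apply: eq_bigr => b _ /=.
by rewrite -big_split; apply: eq_bigr => c _; rewrite /= mulrDr.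
Qed.

Let contrN A X F :
  contr A X (fun a b c => - F a b c) = - contr A X F.
Proof.
rewrite /contr -sumrN; apply: eq_bigr => a _ /=.
rewrite -sumrN; apply: eq_bigr => b _ /=.
by rewrite -sumrN; apply: eq_bigr => c _; rewrite /= mulrN.
Qed.

Let contr_sym A X F : (forall a b, A a b = A b a) ->
  contr A X (fun a b c => F b a c) = contr A X F.
Proof.
move=> sA; rewrite /contr exchange_big; apply: eq_bigr => a _.
by apply: eq_bigr => b _; apply: eq_bigr => c _; rewrite sA.
Qed.

Let contr_sym3 X F :
  contr (fun a b => X a * X b) X (fun a b c => F a c b)
    = contr (fun a b => X a * X b) X F.
Proof.
rewrite /contr; apply: eq_bigr => a _; rewrite exchange_big.
apply: eq_bigr => b _; apply: eq_bigr => c _ /=.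
by congr (_ * _); apply: mulrAC.
Qed.

Let contr_ext A X F F' : (forall a b c, F a b c = F' a b c) ->
  contr A X F = contr A X F'.
Proof.
move=> E; apply: eq_bigr => a _; apply: eq_bigr => b _.
by apply: eq_bigr => c _; rewrite E.
Qed.

(** Let Q be the contraction of P with X twice and T that of D with X three times.
    Differentiating p = G X gives Q = S + T, where S contracts dX with X and p;
    differentiating p X = constant gives S + Q = 0.  Hence 2 Q = T, and by the
    symmetries of a triple contraction with X the Christoffel term contributes
    - T / 2. *)
Lemma hessian_contraction (G P dX : 'I_n -> 'I_n -> R)
    (D : 'I_n -> 'I_n -> 'I_n -> R) X (p : 'I_n -> R) :
  (forall a b, P a b = \sum_c (dX a c * G c b + X c * D a c b)) ->
  (forall b, p b = \sum_c G b c * X c) ->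
  (forall a, \sum_b (dX a b * p b + X b * P a b) = 0) ->
  \sum_a \sum_b X a * X b *
    (P a b - 2^-1 * \sum_c X c * (D a b c + D b a c - D c a b)) = 0.
Proof.
move=> PE pE eqn.
pose XX a b := X a * X b.
pose Q := \sum_a X a * \sum_b X b * P a b.
pose S := \sum_a X a * \sum_b dX a b * p b.
pose T := contr XX X D.
have sXX a b : XX a b = XX b a by rewrite /XX mulrC.
have SQ : S + Q = 0.
  rewrite /S /Q -big_split big1 // => a _ /=.
  by rewrite -mulrDr -big_split /= eqn mulr0.
have QE : Q = S + T.
  rewrite /T -contr_sym3 /Q /S /contr -big_split; apply: eq_bigr => a _ /=.
  have -> : \sum_b dX a b * p b = \sum_b \sum_c X b * (dX a c * G c b).
    rewrite exchange_big; apply: eq_bigr => c _ /=.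
    rewrite pE big_distrr; apply: eq_bigr => b _ /=; ring.
  rewrite !big_distrr -big_split; apply: eq_bigr => b _ /=.
  rewrite PE !big_distrr -big_split; apply: eq_bigr => c _ /=.
  rewrite /XX; ring.
have DE : \sum_a \sum_b X a * X b *
    (P a b - 2^-1 * \sum_c X c * (D a b c + D b a c - D c a b))
  = Q - 2^-1 * contr XX X (fun a b c => D a b c + D b a c + - D c a b).
  rewrite /Q /contr [2^-1 * _]big_distrr -sumrB; apply: eq_bigr => a _ /=.
  rewrite !big_distrr -sumrB; apply: eq_bigr => b _ /=.
  have -> : \sum_c XX a b * X c * (D a b c + D b a c - D c a b)
     = X a * X b * \sum_c X c * (D a b c + D b a c - D c a b).
    by rewrite big_distrr; apply: eq_bigr => c _; rewrite /XX /=; ring.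
  ring.
have T2 : contr XX X (fun a b c => D b a c) = T by rewrite contr_sym.
have T3 : contr XX X (fun a b c => D c a b) = T.
  by rewrite -T2 -[LHS]contr_sym3.
rewrite DE !contrD contrN T2 T3 -/T.
by move: SQ QE; lra.
Qed.

(** Differentiating p = G X turns the trace of P into the divergence of X plus
    derivatives of G; the symmetry of the trace in its two indices cancels all of
    these except the trace of D in its last two indices, which is the divergence
    correction. *)
Lemma laplacian_contraction (Ginv G P dX : 'I_n -> 'I_n -> R)
    (D : 'I_n -> 'I_n -> 'I_n -> R) X :
  (forall a b, P a b = \sum_c (dX a c * G c b + X c * D a c b)) ->
  (forall a b, Ginv a b = Ginv b a) ->
  (forall a b, \sum_c Ginv a c * G b c = (a == b)%:R) ->
  (forall a b c, D a b c = D a c b) ->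
  \sum_a \sum_b Ginv a b *
    (P a b - 2^-1 * \sum_c X c * (D a b c + D b a c - D c a b))
  = \sum_a (dX a a + \sum_b (2^-1 * \sum_c Ginv a c *
              (D a b c + D b a c - D c a b)) * X b).
Proof.
move=> PE sGinv GinvG sD.
pose T := contr Ginv X D.
have LE : \sum_a \sum_b Ginv a b *
    (P a b - 2^-1 * \sum_c X c * (D a b c + D b a c - D c a b))
  = \sum_a dX a a + (contr Ginv X (fun a b c => D a c b)
    - 2^-1 * contr Ginv X (fun a b c => D a b c + D b a c + - D c a b)).
  rewrite /contr [2^-1 * _]big_distrr -sumrB -big_split; apply: eq_bigr => a _ /=.
  have -> : dX a a = \sum_b \sum_c Ginv a b * (dX a c * G c b).
    rewrite exchange_big (eq_bigr (fun c => dX a c * (a == c)%:R)) => [|c _].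
      rewrite (bigD1 a) //= big1 ?addr0 => [|c /negPf ca]; last first.
        by rewrite eq_sym ca mulr0.
      by rewrite eqxx mulr1.
    by rewrite -GinvG big_distrr; apply: eq_bigr => b _ /=; ring.
  rewrite !big_distrr -sumrB -big_split; apply: eq_bigr => b _ /=.
  rewrite PE mulrBr.
  have -> : Ginv a b * (2^-1 * (\sum_c X c * (D a b c + D b a c - D c a b)))
    = 2^-1 * \sum_c Ginv a b * X c * (D a b c + D b a c - D c a b).
    rewrite mulrCA; congr (_ * _); rewrite big_distrr.
    by apply: eq_bigr => c _ /=; ring.
  rewrite addrA; congr (_ - _); rewrite big_distrr -big_split.
  by apply: eq_bigr => c _ /=; ring.
have RE : \sum_a (dX a a + \sum_b (2^-1 * \sum_c Ginv a c *
              (D a b c + D b a c - D c a b)) * X b)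
  = \sum_a dX a a
    + 2^-1 * contr Ginv X (fun a b c => D a c b + D c a b + - D b a c).
  rewrite big_split; congr (_ + _); rewrite /contr big_distrr.
  apply: eq_bigr => a _ /=; rewrite [in RHS]exchange_big big_distrr.
  apply: eq_bigr => b _ /=; rewrite -mulrA; congr (_ * _).
  by rewrite big_distrl; apply: eq_bigr => c _ /=; ring.
have T1 : contr Ginv X (fun a b c => D a c b) = T.
  by apply: contr_ext => a b c; rewrite sD.
have T2 : contr Ginv X (fun a b c => D b a c) = T by rewrite contr_sym.
rewrite LE RE !contrD !contrN T1 T2 -/T; congr (_ + _); lra.
Qed.

End Contractions.

(** * Functions with a gradient of constant norm *)

Section UnitGradient.
Context {R : realType} (n : nat).
Variables (G : 'rV[R]_n -> 'M[R]_n) (p : 'rV[R]_n -> R) (y : 'rV[R]_n) (s : R).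

Lemma gradient_mulmx z :
  G z \in unitmx -> gradient G p z *m G z = differential p z.
Proof. by move=> uG; rewrite /gradient mulmxKV. Qed.


Hypothesis symG : \forall z \near y, (G z)^T = G z.
Hypothesis unitG : \forall z \near y, G z \in unitmx.
Hypothesis dG : forall a b, differentiable (fun z => G z a b : R) y.
Hypothesis ddp : forall b, differentiable (pd b p) y.
Hypothesis gradp : \forall z \near y,
  gradient G p z *m (differential p z)^T = s%:M.

Let X a := gradient G p y ord0 a.
Let dX a b := pd a (fun z => gradient G p z ord0 b) y.
Let D a b c := pd a (fun z => G z b c) y.
Let P a b := pd a (pd b p) y.

Let dgrad b : differentiable (fun z => gradient G p z ord0 b : R) y.
Proof.
have -> : (fun z => gradient G p z ord0 b : R)
    = (fun z => \sum_c pd c p z * invmx (G z) c b).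
  apply/funext => z; rewrite mxE; apply: eq_bigr => c _.
  by congr (_ * _); rewrite mxE.
apply: differentiable_bigsum => c; apply: differentiableM; first exact: ddp.
exact: (differentiable_invmx _ _ dG unitG).
Qed.

Let sD a b c : D a b c = D a c b.
Proof.
apply: pd_near_eq; apply: filterS symG => z Gz.
by rewrite -[in LHS]Gz mxE.
Qed.

Let pE b : pd b p y = \sum_c G y b c * X c.
Proof.
have Gy := nbhs_singleton symG; have uy := nbhs_singleton unitG.
have := congr1 (fun v : 'rV_n => v ord0 b) (gradient_mulmx uy).
rewrite /= [RHS]mxE => <-; rewrite mxE; apply: eq_bigr => c _.
by rewrite -[in LHS]Gy [_^T _ _]mxE mulrC.
Qed.

Let PE a b : P a b = \sum_c (dX a c * G y c b + X c * D a c b).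
Proof.
rewrite /P (@pd_near_eq _ _ _ _
  (fun z => \sum_c gradient G p z ord0 c * G z c b)); last first.
  apply: filterS unitG => z uz.
  have := congr1 (fun v : 'rV_n => v ord0 b) (gradient_mulmx uz).
  by rewrite /= [RHS]mxE [LHS]mxE.
rewrite pd_sum => [|c]; last exact: (differentiableM (dgrad c) (dG c b)).
by apply: eq_bigr => c _; rewrite (pdM a (dgrad c) (dG c b)).
Qed.

Let constant_norm a : \sum_b (dX a b * pd b p y + X b * P a b) = 0.
Proof.
have E : pd a (fun z => \sum_b gradient G p z ord0 b * pd b p z) y = 0.
  apply: etrans (pd_cst a s y); apply: pd_near_eq; apply: filterS gradp => z gz.
  have := congr1 (fun A : 'M[R]_1 => A ord0 ord0) gz.
  rewrite /= [LHS]mxE [RHS]mxE eqxx mulr1n => <-.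
  by apply: eq_bigr => b _; congr (_ * _); rewrite !mxE.
apply: etrans E.
rewrite [RHS]pd_sum => [|c]; last exact: (differentiableM (dgrad c) (ddp c)).
by apply: eq_bigr => c _; rewrite (pdM a (dgrad c) (ddp c)).
Qed.

Let hessianE a b : hessian G p y a b
  = P a b - 2^-1 * \sum_c X c * (D a b c + D b a c - D c a b).
Proof.
rewrite /hessian; congr (_ - _).
rewrite big_distrr /=.
have XE l : X l = \sum_c pd c p y * invmx (G y) c l.
  rewrite /X mxE; apply: eq_bigr => c _; by congr (_ * _); rewrite mxE.
under [RHS]eq_bigr => l _ do rewrite XE mulrCA mulrC big_distrr /=.
rewrite exchange_big; apply: eq_bigr => c _ /=.
rewrite /christoffel big_distrr big_distrl; apply: eq_bigr => l _ /=.
rewrite -/(D a b l) -/(D b a l) -/(D l a b); ring.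
Qed.

(** The geometric meaning: integral curves of a gradient field of constant norm
    are geodesics. *)
Lemma hessian_gradient_gradient :
  \sum_a \sum_b gradient G p y ord0 a * gradient G p y ord0 b
    * hessian G p y a b = 0.
Proof.
apply: etrans (hessian_contraction PE pE constant_norm).
by apply: eq_bigr => a _; apply: eq_bigr => b _; rewrite hessianE.
Qed.

Lemma trace_hessian :
  \sum_a \sum_b invmx (G y) a b * hessian G p y a b
    = divergence G (gradient G p) y.
Proof.
have Gy := nbhs_singleton symG; have uy := nbhs_singleton unitG.
have sGi a b : invmx (G y) a b = invmx (G y) b a.
  by rewrite -[in LHS]Gy -trmx_inv mxE.
have GiG a b : \sum_c invmx (G y) a c * G y b c = (a == b)%:R.
  have := congr1 (fun A : 'M[R]_n => A a b) (mulVmx uy).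
  rewrite /= [LHS]mxE [RHS]mxE => <-; apply: eq_bigr => c _.
  by congr (_ * _); rewrite -[in LHS]Gy mxE.
rewrite /divergence -(laplacian_contraction PE sGi GiG sD).
by apply: eq_bigr => a _; apply: eq_bigr => b _; rewrite hessianE.
Qed.

Lemma hessian_comp (f : R -> R) a b :
  (\forall z \near y, differentiable p z) ->
  (\forall z \near y, derivable f (p z) 1) ->
  derivable (derive1 f) (p y) 1 ->
  hessian G (fun z => f (p z)) y a b
    = derive1 (derive1 f) (p y) * pd a p y * pd b p y
      + derive1 f (p y) * hessian G p y a b.
Proof.
move=> dp df ddf.
have dpy := nbhs_singleton dp.
have pdE c : \forall z \near y,
    pd c (fun z => f (p z)) z = derive1 f (p z) * pd c p z.
  by apply: filterS2 dp df => z; exact: pd_comp1.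
have dfp : differentiable (fun z => derive1 f (p z)) y.
  apply: (@differentiable_comp _ _ _ _ p (derive1 f)) => //.
  exact/derivable1_diffP.
rewrite /hessian (pd_near_eq a (pdE b)) (pdM a dfp (ddp b)).
rewrite (pd_comp1 a dpy ddf) mulrBr -!addrA; congr (_ + (_ + _)).
rewrite big_distrr; congr (- _); apply: eq_bigr => c _.
by rewrite (nbhs_singleton (pdE c)) /= mulrCA.
Qed.

End UnitGradient.

Section RankOne.
Context {R : realType} (n : nat).
Variables (G : 'M[R]_n) (X d : 'rV[R]_n) (s k : R).
Hypotheses (symG : G^T = G) (unitG : G \in unitmx).
Hypotheses (XG : X *m G = d) (Xd : X *m d^T = s%:M).

(** The row X is mapped by the updated matrix to (1 + k s) d; if this were 0, then
    X = 0, against X d^T = s. *)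
Lemma rank_one_update_neq0 :
  s != 0 -> G + k *: (d^T *m d) \in unitmx -> 1 + k * s != 0.
Proof.
move=> s0 U; apply/eqP => W0; case/eqP: s0.
have X0 : X = 0.
  rewrite -(mulmxK U X) mulmxDr XG -scalemxAr mulmxA Xd mul_scalar_mx scalerA.
  by rewrite -[X in X + _]scale1r -scalerDl W0 scale0r mul0mx.
by have := congr1 (fun A : 'M[R]_1 => A ord0 ord0) Xd; rewrite X0 mul0mx !mxE eqxx.
Qed.

(** The Sherman-Morrison formula. *)
Lemma invmx_rank_one_update :
  1 + k * s != 0 ->
  invmx (G + k *: (d^T *m d)) = invmx G - (k / (1 + k * s)) *: (X^T *m X).
Proof.
move=> W0; apply: invmx_uniq.
have GX : G *m X^T = d^T by rewrite -XG trmx_mul symG.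
have dG : d *m invmx G = X by rewrite -XG mulmxK.
have dX : d *m X^T = s%:M by rewrite -[d]trmxK -trmx_mul Xd tr_scalar_mx.
rewrite mulmxDl !mulmxBr mulmxV // -!scalemxAl -!scalemxAr -!mulmxA dG.
rewrite [d *m (X^T *m X)]mulmxA dX [G *m (_ *m _)]mulmxA GX.
rewrite mul_scalar_mx -scalemxAr scalerA scalerA -addrA -[RHS]addr0.
congr (_ + _); rewrite -scaleNr -scalerBl -scalerDl.
rewrite (_ : _ + _ = 0) ?scale0r //; field; exact: W0.
Qed.

End RankOne.

(** * The soliton equation of a function of such a function *)

Section SolitonODE.
Context {R : realType} (n : nat).

(** The trace of Hess (f o p) = f'' dp dp + f' Hess p against the rank one update
    of G^-1 only involves dp(X) = et, Hess p (X, X) = 0 and the Laplacian of p. *)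
Lemma graph_soliton_ode (G : 'rV[R]_n -> 'M[R]_n) (p : 'rV[R]_n -> R)
    (f : R -> R) (e et : R) (y : 'rV[R]_n) :
  (\forall z \near y, (G z)^T = G z) ->
  (\forall z \near y, G z \in unitmx) ->
  (forall a b, differentiable (fun z => G z a b : R) y) ->
  (\forall z \near y, differentiable p z) ->
  (forall b, differentiable (pd b p) y) ->
  et ^+ 2 = 1 ->
  (\forall z \near y, gradient G p z *m (differential p z)^T = et%:M) ->
  (\forall z \near y, derivable f (p z) 1) ->
  derivable (derive1 f) (p y) 1 ->
  let u z := f (p z) in
  let gamma := G y + e *: ((differential u y)^T *m differential u y) in
  gamma \in unitmx ->
  \sum_a \sum_b invmx gamma a b * hessian G u y a b = 1 <->
  derive1 (derive1 f) (p y)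
    = (et + e * derive1 f (p y) ^+ 2)
      * (1 - derive1 f (p y) * divergence G (gradient G p) y).
Proof.
move=> symG unitG dG dp ddp et2 gradp df ddf u gamma.
have Gy := nbhs_singleton symG; have uy := nbhs_singleton unitG.
have gy := nbhs_singleton gradp; have dpy := nbhs_singleton dp.
set d := differential p y in gy; set X := gradient G p y in gy.
set f1 := derive1 f (p y); set f2 := derive1 (derive1 f) (p y).
set L := divergence _ _ _.
have duE : differential u y = f1 *: d.
  apply/rowP => a; rewrite [LHS]mxE [RHS]mxE [X in _ * X]mxE.
  by rewrite (pd_comp1 a dpy (nbhs_singleton df)).
have gammaE : gamma = G y + (e * f1 ^+ 2) *: (d^T *m d).
  have trd : (f1 *: d)^T = f1 *: d^T by rewrite linearZ.
  by rewrite /gamma duE trd -scalemxAl -scalemxAr !scalerA expr2 mulrA.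
rewrite gammaE => U.
have et0 : et != 0 by apply/eqP => E; move: et2; rewrite E expr0n /=; lra.
have XG : X *m G y = d := gradient_mulmx p uy.
have W0 := rank_one_update_neq0 XG gy et0 U.
rewrite (invmx_rank_one_update Gy uy XG gy W0).
set k := e * f1 ^+ 2 in W0 *; set c := k / (1 + k * et).
have Xp : \sum_b X ord0 b * d ord0 b = et.
  have := congr1 (fun A : 'M[R]_1 => A ord0 ord0) gy.
  rewrite /= [LHS]mxE [RHS]mxE eqxx mulr1n => <-.
  by apply: eq_bigr => b _; congr (_ * _); rewrite [RHS]mxE.
have pp : \sum_a \sum_b invmx (G y) a b * (d ord0 a * d ord0 b) = et.
  rewrite exchange_big -[RHS]Xp; apply: eq_bigr => b _ /=.
  rewrite [X _ _]mxE big_distrl; apply: eq_bigr => a _ /=.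
  ring.
have XXpp : \sum_a \sum_b X ord0 a * X ord0 b * (d ord0 a * d ord0 b) = 1.
  rewrite -et2 expr2 -{1}Xp big_distrl; apply: eq_bigr => a _ /=.
  by rewrite -Xp big_distrr; apply: eq_bigr => b _ /=; ring.
have XXH : \sum_a \sum_b X ord0 a * X ord0 b * hessian G p y a b = 0.
  exact: hessian_gradient_gradient symG unitG dG ddp gradp.
have trH : \sum_a \sum_b invmx (G y) a b * hessian G p y a b = L.
  exact: trace_hessian symG unitG dG ddp.
have -> : \sum_a \sum_b (invmx (G y) - c *: (X^T *m X)) a b * hessian G u y a b
   = f2 * (et - c) + f1 * L.
  transitivity (f2 * (\sum_a \sum_b invmx (G y) a b * (d ord0 a * d ord0 b)
      - c * \sum_a \sum_b X ord0 a * X ord0 b * (d ord0 a * d ord0 b))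
    + f1 * (\sum_a \sum_b invmx (G y) a b * hessian G p y a b
      - c * \sum_a \sum_b X ord0 a * X ord0 b * hessian G p y a b)); last first.
    by rewrite pp XXpp XXH trH; ring.
  rewrite ![c * _]big_distrr -!sumrB !big_distrr -big_split.
  apply: eq_bigr => a _ /=.
  rewrite ![c * _]big_distrr -!sumrB !big_distrr -big_split.
  apply: eq_bigr => b _ /=.
  rewrite (hessian_comp G ddp a b dp df ddf) -/f1 -/f2.
  have -> : (invmx (G y) - c *: (X^T *m X)) a b
     = invmx (G y) a b - c * (X ord0 a * X ord0 b).
    rewrite [LHS]mxE; congr (_ + _); rewrite [LHS]mxE [X in - X]mxE.
    rewrite [X in _ * X]mxE big_ord1; congr (- (_ * (_ * _))).
    by rewrite mxE.
  have -> : pd a p y = d ord0 a by rewrite [RHS]mxE.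
  have -> : pd b p y = d ord0 b by rewrite [RHS]mxE.
  ring.
have WE : et + k = et * (1 + k * et).
  by rewrite mulrDr mulr1 mulrCA -expr2 et2 mulr1.
have quotient (W : R) : W != 0 -> et + k = et * W -> et - k / W = et / W.
  by move=> Wn0 E; apply: (mulIf Wn0); rewrite mulrBl !divfK // -E addrK.
have cE : et - c = et / (1 + k * et) := quotient _ W0 WE.
rewrite cE WE; set W := 1 + k * et in W0 *; split=> [E|->].
  have -> : 1 - f1 * L = f2 * (et / W) by rewrite -E addrK.
  transitivity (et ^+ 2 * f2); first by rewrite et2 mul1r.
  field; exact: W0.
have -> : et * W * (1 - f1 * L) * (et / W) = et ^+ 2 * (1 - f1 * L).
  field; exact: W0.
by rewrite et2 mul1r subrK.
Qed.

End SolitonODE.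

(** * Regularity of a function factored through another one *)

Section RealFunctions.
Context {R : realType}.
Implicit Types f w rho : R -> R.

Let quotient_rule (a b da db : R) : b != 0 ->
  a * (- b ^- 2 * db) + b^-1 * da = (da * b - a * db) / b ^+ 2.
Proof. by move=> b0; field. Qed.

(** Where the derivative does not vanish, Rolle's theorem forbids taking a value
    twice. *)
Lemma near_left_inverse rho (t0 : R) :
  (\forall t \near t0, derivable rho t 1) ->
  {for t0, continuous (derive1 rho)} -> derive1 rho t0 != 0 ->
  exists theta : R -> R, {near t0, cancel rho theta}.
Proof.
move=> drho crho rho0.
have near0 : \forall t \near t0, derive1 rho t != 0.
  exact: (crho [set s | s != 0]) (open_nbhs_nbhs (conj (@open_neq _ _) rho0)).
have : \forall t \near t0, derivable rho t 1 /\ derive1 rho t != 0.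
  exact: filterI drho near0.
move=> /nbhs_ballP[d /= d0 dball].
exists (fun s => xget t0 [set t | ball t0 d t /\ rho t = s]).
near=> t.
have bt : ball t0 d t by near: t; exact: nbhsx_ballx.
have [|bx rx] := @xgetPex _ t0 [set t' | ball t0 d t' /\ rho t' = rho t].
  by exists t.
set x := xget _ _ in bx rx *.
have inj a b : ball t0 d a -> ball t0 d b -> a < b -> rho a = rho b -> False.
  move=> ba bb ab rab.
  have bc c : c \in `[a, b]%R -> ball t0 d c.
    rewrite in_itv /= => /andP[ac cb]; move: ba bb.
    rewrite /ball /= !ltr_distlC => /andP[a1 a2] /andP[b1 b2].
    by rewrite (lt_le_trans a1 ac) (le_lt_trans cb b2).
  have [||c cab [_ dc]] := @Rolle _ rho a b ab _ _ rab.
  - move=> c cab; apply: (dball c _).1; apply: bc.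
    exact: subset_itv_oo_cc cab.
  - apply: derivable_within_continuous => c cab.
    exact: (dball c (bc _ cab)).1.
  have := (dball c (bc _ (subset_itv_oo_cc cab))).2.
  by rewrite /= derive1E dc eqxx.
have [xt|tx|//] := ltgtP x t.
- by case: (inj _ _ bx bt xt).
- by case: (inj _ _ bt bx tx).
Unshelve. all: by end_near. Qed.

Section Factor.
Variables (f w rho : R -> R) (t0 : R).
Hypothesis drho : \forall t \near t0, derivable rho t 1.
Hypothesis crho : {for t0, continuous (derive1 rho)}.
Hypothesis rho0 : derive1 rho t0 != 0.
Hypothesis frho : \forall t \near t0, f (rho t) = w t.

Let local_inverse : exists theta : R -> R,
  [/\ theta (rho t0) = t0, is_derive (rho t0) 1 theta (derive1 rho t0)^-1 &
      \forall s \near rho t0, w (theta s) = f s].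
Proof.
have [theta thK] := near_left_inverse drho crho rho0.
have crho1 : {near t0, continuous rho}.
  by apply: filterS drho => t /derivable1_diffP/differentiable_continuous.
have thE : theta (rho t0) = t0 := nbhs_singleton thK.
have dth : is_derive (rho t0) 1 theta (derive1 rho t0)^-1.
  apply: is_derive_inverse thK crho1 _ rho0.
  by rewrite derive1E; apply: derivableP; apply: nbhs_singleton drho.
exists theta; split => //.
have rhK := near_continuous_can_sym crho1 thK.
have cth : {for rho t0, continuous theta}.
  by apply: differentiable_continuous; apply/derivable1_diffP; case: dth.
have wth : \forall s \near rho t0, f (rho (theta s)) = w (theta s).
  have cth0 : theta s @[s --> rho t0] --> t0 by rewrite -{2}thE; exact: cth.
  exact: (cth0 _ frho).
by apply: filterS2 rhK wth => s; rewrite /= => -> ->.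
Qed.

(** Near rho t0, f is the composite of w with the local inverse of rho. *)
Lemma is_derive_factor dw :
  is_derive t0 1 w dw -> is_derive (rho t0) 1 f (dw / derive1 rho t0).
Proof.
move=> dwt; have [theta [thE dth wth]] := local_inverse.
apply: near_eq_is_derive wth _.
by apply: is_derive1_comp; rewrite thE.
Qed.

Lemma continuous_factor :
  {for t0, continuous w} -> {for rho t0, continuous f}.
Proof.
move=> cw; have [theta [thE dth wth]] := local_inverse.
have cth : {for rho t0, continuous theta}.
  by apply: differentiable_continuous; apply/derivable1_diffP; case: dth.
have fE : f (rho t0) = w (theta (rho t0)) := esym (nbhs_singleton wth).
have cwth : w (theta s) @[s --> rho t0] --> w (theta (rho t0)).
  by apply: (@continuous_comp _ _ _ theta w) => //; rewrite thE.
have : f s @[s --> rho t0] --> w (theta (rho t0)).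
  by apply: cvg_trans cwth; exact: near_eq_cvg.
by rewrite -fE.
Qed.

End Factor.

Definition C2_at f (t : R) : Prop :=
  [/\ derivable f t 1, derivable (derive1 f) t 1 &
      {for t, continuous (derive1 (derive1 f))}].

(** The first derivative of f is again a quotient factored through rho, so the
    first-order rule applies to it in turn.  The hypotheses are required near t0
    because that rule is differentiated. *)
Lemma C2_at_factor f w rho (t0 : R) :
  (\forall t \near t0, C2_at rho t) -> derive1 rho t0 != 0 ->
  (\forall t \near t0, C2_at w t) ->
  (\forall t \near t0, f (rho t) = w t) -> C2_at f (rho t0).
Proof.
move=> Crho rho0 Cw frho.
have drho : \forall t \near t0, derivable rho t 1 by apply: filterS Crho => t [].
have crho : \forall t \near t0, {for t, continuous (derive1 rho)}.
  apply: filterS Crho => t [_ d _].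
  by apply: differentiable_continuous; apply/derivable1_diffP.
have near0 : \forall t \near t0, derive1 rho t != 0.
  exact: (nbhs_singleton crho [set s | s != 0])
    (open_nbhs_nbhs (conj (@open_neq _ _) rho0)).
(* The first derivative of f pulled back by rho, and the derivative of that. *)
pose w1 (t : R) : R := derive1 w t / derive1 rho t.
pose w2 (t : R) : R := (derive1 (derive1 w) t * derive1 rho t
  - derive1 w t * derive1 (derive1 rho) t) / derive1 rho t ^+ 2.
have dw1 : nbhs t0 [set t : R | is_derive t 1 w1 (w2 t)].
  apply: filterS3 Cw Crho near0 => t [_ ddw _] [_ ddrho _] rt0 /=.
  have dV := is_deriveV rt0 (derivableP ddrho).
  have dM := is_deriveM (derivableP ddw) dV.
  apply: is_derive_eq dM _; rewrite -!derive1E.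
  exact: (quotient_rule _ _ _ rt0).
have drho2 : \forall t \near t0, \forall s \near t, derivable rho s 1.
  exact: (near_join drho).
have reg : \forall t \near t0,
    derive1 rho t != 0 /\ {for t, continuous (derive1 rho)}.
  exact: (filterI near0 crho).
have f1 : \forall t \near t0, derive1 f (rho t) = w1 t.
  have frho2 : \forall t \near t0, \forall s \near t, f (rho s) = w s.
    exact: (near_join frho).
  have Cwt : \forall t \near t0, C2_at w t /\
      (derive1 rho t != 0 /\ {for t, continuous (derive1 rho)}).
    exact: (filterI Cw reg).
  apply: filterS3 drho2 frho2 Cwt => t drhot frhot [[dw _ _] [rt0 crhot]].
  rewrite /w1 derive1E; apply: derive_val.
  apply: (is_derive_factor drhot crhot rt0 frhot).
  by rewrite derive1E; exact: derivableP.
have f2 : \forall t \near t0, derive1 (derive1 f) (rho t) = w2 t / derive1 rho t.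
  have frho2 : \forall t \near t0, \forall s \near t,
      derive1 f (rho s) = w1 s.
    exact: (near_join f1).
  have w1rho : \forall t \near t0, is_derive t (1 : R) w1 (w2 t) /\
      (derive1 rho t != 0 /\ {for t, continuous (derive1 rho)}).
    exact: (filterI dw1 reg).
  apply: filterS3 drho2 frho2 w1rho => t drhot frhot [dwt [rt0 crhot]].
  rewrite derive1E; apply: derive_val.
  exact: (is_derive_factor drhot crhot rt0 frhot).
split.
- have [dw _ _] := nbhs_singleton Cw.
  have [] // := @is_derive_factor f w rho t0 drho (nbhs_singleton crho) rho0 frho
    (derive1 w t0).
  by rewrite derive1E; exact: derivableP.
- by have [] // := @is_derive_factor _ w1 rho t0 drho (nbhs_singleton crho) rho0 f1
    _ (nbhs_singleton dw1).
apply: (continuous_factor drho (nbhs_singleton crho) rho0 f2).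
have cV (g : R -> R) : {for t0, continuous g} ->
    {for t0, continuous (fun t : R => g t / derive1 rho t : R)}.
  by move=> cg; apply: continuousM => //; apply: continuousV => //;
    exact: nbhs_singleton crho.
apply: (cV w2).
have [_ dw1t cw2] := nbhs_singleton Cw; have [_ drho1t crho2] := nbhs_singleton Crho.
have cw1 : {for t0, continuous (derive1 w)}.
  by apply: differentiable_continuous; apply/derivable1_diffP.
apply: continuousM; last first.
  apply: continuousV; first by rewrite sqrf_eq0.
  by apply: continuousM; exact: nbhs_singleton crho.
have crt := nbhs_singleton crho.
exact: (continuousB (continuousM cw2 crt) (continuousM cw1 crho2)).
Qed.

End RealFunctions.

(** * Functions of class C2 on lines and on intervals *)

Section C2.
Context {R : realType}.

Lemma continuous_line n (y v : 'rV[R]_n) (t : R) :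
  {for t, continuous (fun r : R => r *: v + y)}.
Proof.
exact: (@differentiable_continuous _ R 'rV[R]_n t (fun r : R => r *: v + y)).
Qed.

Lemma derivable_line n (phi : 'rV[R]_n -> R) (y v : 'rV[R]_n) (t : R) :
  differentiable phi (t *: v + y) ->
  derivable (fun r : R => phi (r *: v + y)) t 1.
Proof.
move=> dphi; apply/derivable1_diffP.
by apply: (@differentiable_comp _ _ _ _ (fun r : R => r *: v + y) phi).
Qed.

(** An equality of functions without any differentiability: the two difference
    quotients coincide. *)
Lemma derive1_line n (phi : 'rV[R]_n -> R) (y v : 'rV[R]_n) :
  derive1 (fun r : R => phi (r *: v + y)) = (fun r => 'D_v phi (r *: v + y)).
Proof.
apply/funext => t; rewrite /derive1 /derive.
suff -> : (fun h : R => h^-1 *: (phi ((h + t) *: v + y) - phi (t *: v + y)))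
  = (fun h => h^-1 *: ((phi \o shift (t *: v + y)) (h *: v) - phi (t *: v + y))).
  by [].
by apply/funext => h; rewrite /= scalerDl addrA.
Qed.

Lemma C2_at_line n (phi : 'rV[R]_n -> R) (U : set 'rV[R]_n) (y v : 'rV[R]_n)
    (t : R) :
  Ck 2 U phi -> U (t *: v + y) -> C2_at (fun r : R => phi (r *: v + y)) t.
Proof.
move=> [dphi /(_ v)[ddphi /(_ v) cphi]] Ut; split.
- by apply: derivable_line; apply: dphi.
- by rewrite derive1_line; exact: (derivable_line (ddphi _ Ut)).
- rewrite derive1_line (derive1_line ('D_v phi)).
  exact: (@continuous_comp R 'rV[R]_n R (fun r : R => r *: v + y)
    ('D_v ('D_v phi)) t (@continuous_line n y v t) (cphi _ Ut)).
Qed.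

Lemma near_line n (U : set 'rV[R]_n) (y v : 'rV[R]_n) :
  open U -> U y -> \forall t \near (0 : R), U (t *: v + y).
Proof.
move=> Uo Uy.
apply: (@continuous_line n y v 0 U).
by rewrite scale0r add0r; apply: open_nbhs_nbhs.
Qed.

Lemma derive_scale (f : R -> R) (x v : R) :
  derivable f x 1 -> 'D_v f x = v * derive1 f x.
Proof.
move=> /derivable1_diffP df; rewrite deriveE // derive1E' //.
by rewrite -[v in LHS]mulr1 [LHS]linearZ.
Qed.

(** Directional derivatives of a function on the line are multiples of its
    derivative, but only where it is differentiable; off the open set I this may
    fail, so the multiples are compared near each point of I. *)
Lemma Ck2_C2_at (I : set R) (f : R -> R) : open I ->
  Ck 2 I f <-> forall s, I s -> C2_at f s.
Proof.
move=> Io; split=> [[df ddf] s Is|C2f].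
  have D1 (g : R -> R) : derive1 g = 'D_1 g by apply/funext => t; rewrite derive1E.
  have [ddf1 cf] := ddf 1.
  split; first by apply: diff_derivable; apply: df.
    by rewrite D1; apply: diff_derivable; apply: ddf1.
  by rewrite (D1 f) (D1 ('D_1 f)); apply: cf.
have nearI s : I s -> \forall t \near s, I t.
  by move=> Is; apply: open_nbhs_nbhs.
have DE (v s : R) : I s -> \forall t \near s, v * derive1 f t = 'D_v f t.
  move=> /nearI; apply: filterS => t /C2f[df _ _].
  by rewrite derive_scale.
have dDE (v s : R) : I s -> differentiable (fun t => v * derive1 f t) s.
  move=> /C2f[_ /derivable1_diffP ddf _].
  by apply: differentiableM => //; exact: differentiable_cst.
have dD v s : I s -> differentiable ('D_v f) s.
  move=> Is; exact: differentiable_near_eq (DE v s Is) (dDE v s Is).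
split=> [s /C2f[/derivable1_diffP //]|v]; split=> [s|w s Is]; first exact: dD.
have E : \forall t \near s, w * (v * derive1 (derive1 f) t) = 'D_w ('D_v f) t.
  apply: filterS (nearI s Is) => t It.
  have [_ ddf _] := C2f t It.
  rewrite derive_scale; last by apply/derivable1_diffP; exact: dD.
  congr (w * _).
  apply/esym; apply: etrans (derive1E _ _) _.
  apply: etrans (esym (near_eq_derive (1 : R) (DE v t It))) _.
  rewrite (@deriveM _ _ (cst v) (derive1 f)) //.
  by rewrite derive_cst scaler0 addr0 derive1E.
have cE : w * (v * derive1 (derive1 f) t) @[t --> s]
    --> w * (v * derive1 (derive1 f) s).
  have [_ _ cf] := C2f s Is.
  by apply: cvgM; [exact: cvg_cst|apply: cvgM; [exact: cvg_cst|exact: cf]].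
have : 'D_w ('D_v f) t @[t --> s] --> w * (v * derive1 (derive1 f) s).
  by apply: cvg_trans cE; exact: near_eq_cvg.
by have -> := nbhs_singleton E.
Qed.

End C2.

(** * Manifolds read in charts *)

Section Charts.
Context {R : realType} (n : nat) (M : charted_space R n).
Hypothesis hM : smooth_manifold M.
Implicit Types (i j : chart_index M) (p : M).

Lemma chart_inv_coord i p : dom i p -> chart_inv (chart_of i) (coord i p) = p.
Proof. by have [_ _ /(_ i)[_ _ inv _ _] _ _] := hM; exact: inv. Qed.

Lemma chart_img_coord i p : dom i p -> chart_img (chart_of i) (coord i p).
Proof. by move=> ip; exists p. Qed.

Lemma open_chart_img i : open (chart_img (chart_of i)).
Proof. by have [_ _ /(_ i)[]] := hM. Qed.

Lemma near_chart_img i p : dom i p ->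
  \forall z \near coord i p, chart_img (chart_of i) z.
Proof.
move=> ip; apply: open_nbhs_nbhs; split; first exact: open_chart_img.
exact: chart_img_coord.
Qed.

Lemma near_overlap i j p : dom i p -> dom j p ->
  \forall z \near coord i p, (coord i @` (dom i `&` dom j)) z.
Proof.
move=> ip jp; have [_ _ charts _ _] := hM.
have [_ _ _ _ cinv] := charts i; have [oj _ _ _ _] := charts j.
have jinv : \forall z \near coord i p, dom j (chart_inv (chart_of i) z).
  apply: (cinv _ (chart_img_coord ip) (dom j)); rewrite chart_inv_coord //.
  exact: open_nbhs_nbhs.
apply: filterS2 (near_chart_img ip) jinv => z [q iq <-].
by rewrite chart_inv_coord // => jq; exists q.
Qed.

Lemma differentiable_jacobian m k (U : set 'rV[R]_m) (f : 'rV[R]_m -> 'rV[R]_k)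
    (y : 'rV[R]_m) a b :
  Ck 2 U f -> (\forall z \near y, U z) ->
  differentiable (fun z => jacobian f z a b : R) y.
Proof.
move=> [df ddf] nU.
apply: (@differentiable_near_eq _ _ _
  (fun z => 'D_(delta_mx ord0 a) f z ord0 b : R)).
  apply: filterS nU => z Uz; rewrite derive_entry; last exact: df.
  by apply/esym; apply: jacobianE; exact: df.
apply: differentiable_entry; have [ddfa _] := ddf (delta_mx ord0 a).
by apply: ddfa; exact: nbhs_singleton nU.
Qed.

Lemma near_local_fun (u : M -> R) i p : Ck_fun 2 u -> dom i p ->
  (\forall z \near coord i p, differentiable (local_fun u i) z) /\
  (forall b, \forall z \near coord i p, differentiable (pd b (local_fun u i)) z).
Proof.
move=> /(_ i)[du ddu] ip; split=> [|b].
  by apply: filterS (near_chart_img ip) => z; exact: du.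
apply: filterS (near_chart_img ip) => z iz.
by have [ddub _] := ddu (delta_mx ord0 b); exact: ddub.
Qed.

Lemma local_fun_coord (u : M -> R) i p : dom i p ->
  local_fun u i (coord i p) = u p.
Proof. by move=> ip; rewrite /local_fun chart_inv_coord. Qed.

(** The source chart i enters only through the change of coordinates to the chart
    of the target, so that the criterion lives in the latter chart alone. *)
Lemma soliton_equation_in_chart (g : tensor02 M) (e : R) (u : M -> R)
    i (j : chart_index (prod_space M (@real_line R))) p :
  semi_riemannian_metric g -> e != 0 -> Ck_fun 2 u ->
  dom i p -> dom j (graph_map u p) ->
  let G := product_metric g e j in
  let Phi := local_map (graph_map u) i j in
  let du := differential (local_fun u j.1) (coord j.1 p) in
  let gamma := g j.1 (coord j.1 p) + e *: (du^T *m du) in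
  induced_metric G Phi (coord i p) \in unitmx ->
  gamma \in unitmx /\
  (mean_curvature_vector G Phi (coord i p)
     = normal_part G Phi (coord i p) (partial_t n) <->
   \sum_a \sum_b invmx gamma a b
     * hessian (g j.1) (local_fun u j.1) (coord j.1 p) a b = 1).
Proof.
move=> [_ unitg _ _] e0 hu ip jFp G Phi du gamma U.
have jp : dom j.1 p by case: jFp.
pose tau := local_map id i j.1.
have tauE : tau (coord i p) = coord j.1 p.
  by rewrite /tau /local_map chart_inv_coord.
have [nu nddu] := near_local_fun hu jp.
pose Psi := graph_in_chart (local_fun u j.1).
have nov := near_overlap ip jp.
have Ctau : Ck 2 (coord i @` (dom i `&` dom j.1)) tau.
  by have [_ _ _ _ /(_ i j.1 2)] := hM.
have PhiE : \forall z \near coord i p, Phi z = Psi (tau z).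
  apply: filterS nov => z [q [iq jq] <-].
  rewrite /Phi /Psi /tau /local_map /graph_in_chart /local_fun.
  by rewrite (chart_inv_coord iq) (chart_inv_coord jq).
have dtau : \forall z \near coord i p, differentiable tau z.
  by apply: filterS nov => z; exact: Ctau.1.
have dPsi : \forall z \near coord i p, differentiable Psi (tau z).
  apply: filterS nov => z [q [iq jq] <-].
  apply: differentiable_graph_in_chart; apply: (hu j.1).1.
  by rewrite /tau /local_map chart_inv_coord //; exact: chart_img_coord.
have ddtau a b : differentiable (fun z => jacobian tau z a b : R) (coord i p).
  exact: differentiable_jacobian Ctau nov.
have ddPsi a b :
    differentiable (fun x => jacobian Psi x a b : R) (tau (coord i p)).
  rewrite tauE; apply: differentiable_jacobian_graph => // c.
  exact: nbhs_singleton (nddu c).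
have [uM equiv] :=
  trace_cov_derivative_reparam PhiE dtau dPsi ddtau ddPsi U.
have gE : induced_metric G Psi (tau (coord i p)) = gamma.
  rewrite tauE; apply: induced_metric_graph; exact: nbhs_singleton nu.
rewrite gE in uM; split; first exact: uM.
apply: iff_trans (mean_curvature_eq_normal_part _ U) _.
apply: iff_trans (equiv _) _; rewrite tauE in gE *.
have uG := unitg j.1 _ (chart_img_coord jp).
apply: (trace_cov_derivative_graph nu uG e0); rewrite -gE.
by [].
Qed.

(** The gradient X is horizontal because g(X, w) = d pi (w), so its squared norm q
    equals d pi (X) and the isometry condition reads q = et q^2.  If q were 0, X
    would be vertical and horizontal, hence 0, and d pi would not be onto. *)
Lemma submersion_gradient (g : tensor02 M) (I : set R) (et : R) (pi : M -> R)
    i p :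
  semi_riemannian_metric g -> semi_riemannian_submersion g I et pi ->
  et ^+ 2 = 1 -> dom i p ->
  gradient (g i) (local_fun pi i) (coord i p)
    *m (differential (local_fun pi i) (coord i p))^T = et%:M.
Proof.
move=> [_ unitg _ _] [spi _ /(_ i p)sub] et2 ip.
set y := coord i p; set X := gradient _ _ y; set d := differential _ y.
have dpi : differentiable (local_fun pi i) y.
  by apply: (spi 1 i).1; exact: chart_img_coord.
have [nondeg onto isom] := sub ip.
have DE v : 'D_v (local_fun pi i) y = (v *m d^T) ord0 ord0.
  rewrite derive_pd // [RHS]mxE; apply: eq_bigr => a _.
  by rewrite [d^T _ _]mxE [d _ _]mxE.
have Xg : X *m g i y = d.
  by apply: gradient_mulmx; apply: unitg; exact: chart_img_coord.
have XE w : scalar_product (g i y) X w = 'D_w (local_fun pi i) y.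
  rewrite /scalar_product Xg DE -[w in RHS]trmxK -trmx_mul.
  by rewrite [RHS]mxE.
have Xhor w : 'D_w (local_fun pi i) y = 0 -> scalar_product (g i y) X w = 0.
  by rewrite XE.
pose q := 'D_X (local_fun pi i) y.
have qE : q = et * q * q by rewrite -{1}[q]XE; exact: isom.
have q0 : q != 0.
  apply/eqP => q0; have X0 := nondeg X q0 Xhor.
  have [v _ ] := onto 1; rewrite DE -Xg X0 mul0mx trmx0 mulmx0 mxE.
  by move/eqP; rewrite eq_sym oner_eq0.
have qet : q = et.
  apply: (mulfI q0); rewrite -[LHS]mul1r -et2 expr2 -!mulrA.
  by rewrite [et * (q * q)]mulrA -qE mulrC.
apply/matrixP => a b; rewrite (ord1 a) (ord1 b) -[LHS]DE -/q qet.
by rewrite mxE eqxx.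
Qed.

End Charts.

(** * The theorem *)

Section Soliton.
Context {R : realType} (n : nat) (M : charted_space R n).
Hypothesis hM : smooth_manifold M.

(** Since d pi is onto, each point lies on a line of a chart along which pi has
    derivative 1 at that point, and u and pi are C2 along lines. *)
Lemma C2_at_submersion_factor (g : tensor02 M) (I : set R) (et : R)
    (pi : M -> R) (u : M -> R) (f : R -> R) :
  semi_riemannian_submersion g I et pi -> Ck_fun 2 u ->
  (forall x, u x = f (pi x)) -> forall s, I s -> C2_at f s.
Proof.
move=> [spi rpi sub] hu uE s; rewrite -rpi => -[x _ <-].
have [_ _ _ /(_ x)[i ix] _] := hM.
have [_ /(_ 1)[v _ dv] _] := sub i x ix.
set y := coord i x in dv.
have pE : pi x = local_fun pi i (0 *: v + y).
  by rewrite scale0r add0r local_fun_coord.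
rewrite pE.
have nU := near_line v (open_chart_img hM (i := i)) (chart_img_coord ix).
apply: (@C2_at_factor _ f (fun t => local_fun u i (t *: v + y))
  (fun t => local_fun pi i (t *: v + y))).
- by apply: filterS nU => t; apply: C2_at_line; exact: (spi 2 i).
- by rewrite derive1_line scale0r add0r dv oner_eq0.
- by apply: filterS nU => t; apply: C2_at_line; exact: (hu i).
- by apply: filterE => t; rewrite /local_fun uE.
Qed.

Lemma soliton_equation_ode (g : tensor02 M) (I : set R) (e et : R)
    (pi : M -> R) (h : R -> R) (u : M -> R) (f : R -> R)
    i (j : chart_index (prod_space M (@real_line R))) p :
  semi_riemannian_metric g -> e != 0 -> et ^+ 2 = 1 ->
  semi_riemannian_submersion g I et pi ->
  represents_mean_curvature g pi h -> Ck_fun 2 u ->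
  (forall s, I s -> C2_at f s) -> (forall x, u x = f (pi x)) ->
  dom i p -> dom j (graph_map u p) ->
  let G := product_metric g e j in
  let Phi := local_map (graph_map u) i j in
  induced_metric G Phi (coord i p) \in unitmx ->
  mean_curvature_vector G Phi (coord i p)
    = normal_part G Phi (coord i p) (partial_t n) <->
  derive1 (derive1 f) (pi p)
    = (et + e * derive1 f (pi p) ^+ 2) * (1 - derive1 f (pi p) * h (pi p)).
Proof.
move=> hg e0 et2 hpi hh hu Cf uE ip jFp G Phi U.
have [uM equiv] := soliton_equation_in_chart hM hg e0 hu ip jFp U.
apply: iff_trans equiv _.
have jp : dom j.1 p by case: jFp.
have luE : local_fun u j.1 = (fun z => f (local_fun pi j.1 z)).
  by apply/funext => z; rewrite /local_fun uE.
have [symg unitg dg _] := hg; have [spi rpi _] := hpi.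
have nj := near_chart_img hM jp.
have piE := local_fun_coord hM pi jp.
have Ipi z : I (local_fun pi j.1 z).
  by rewrite -rpi; exists (chart_inv (chart_of j.1) z).
have symG : \forall z \near coord j.1 p, (g j.1 z)^T = g j.1 z.
  by apply: filterS nj => z; exact: symg.
have unitG : \forall z \near coord j.1 p, g j.1 z \in unitmx.
  by apply: filterS nj => z; exact: unitg.
have dG a b : differentiable (fun z => g j.1 z a b : R) (coord j.1 p).
  by apply: (dg j.1 a b 1).1; exact: chart_img_coord.
have [ndp nddp] := near_local_fun hM (spi 2) jp.
have gradp : \forall z \near coord j.1 p,
    gradient (g j.1) (local_fun pi j.1) z
      *m (differential (local_fun pi j.1) z)^T = et%:M.
  apply: filterS nj => z [q jq <-].
  exact: submersion_gradient hg hpi et2 jq.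
have df : \forall z \near coord j.1 p, derivable f (local_fun pi j.1 z) 1.
  by apply: filterE => z; have [] := Cf _ (Ipi z).
have ddf : derivable (derive1 f) (local_fun pi j.1 (coord j.1 p)) 1.
  by have [] := Cf _ (Ipi (coord j.1 p)).
have ddp b := nbhs_singleton (nddp b).
rewrite luE in uM *.
apply: iff_trans
  (graph_soliton_ode symG unitG dG ndp ddp et2 gradp df ddf uM) _.
by rewrite (hh j.1 p jp) piE.
Qed.

End Soliton.

Lemma invariant_factor (R : realType) n k (Sigma : charted_space R k)
    (M : charted_space R n) (act : Sigma -> M -> M) (pi u : M -> R) :
  fibers_are_orbits act pi -> action_invariant act u ->
  exists f : R -> R, forall x, u x = f (pi x).
Proof.
move=> horb uinv.
(* Any preimage of s under pi may be used, because u is constant on fibers. *)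
exists (fun s => xget 0 [set r | exists2 x, pi x = s & u x = r]) => x.
have [|x' px' <-] := @xgetPex _ 0 [set r | exists2 x', pi x' = pi x & u x' = r].
  by exists (u x), x.
by have /horb[a ->] := px'; rewrite uinv.
Qed.

Theorem theorem3 (R : realType) (n k : nat)
    (M : charted_space R n) (hM : smooth_manifold M)
    (hconn : connected [set: M])
    (g : tensor02 M) (hg : semi_riemannian_metric g)
    (I : set R) (hI0 : I !=set0) (hIo : open I) (hI : is_interval I)
    (e et : R) (he : e = 1 \/ e = -1) (het : et = 1 \/ et = -1)
    (Sigma : charted_space R k) (mul : Sigma -> Sigma -> Sigma)
    (one : Sigma) (inv : Sigma -> Sigma) (hSigma : lie_group mul one inv)
    (act : Sigma -> M -> M) (hact : smooth_action mul one act)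
    (hiso : acts_by_isometries g act)
    (pi : M -> R) (hpi : semi_riemannian_submersion g I et pi)
    (horb : fibers_are_orbits act pi)
    (h : R -> R) (hh : represents_mean_curvature g pi h)
    (u : M -> R) (hu : Ck_fun 2 u)
    (hF : nondegenerate_induced_metric (product_metric g e) (graph_map u)) :
  (action_invariant act u /\ translating_soliton g e (graph_map u)) <->
  (exists f : R -> R,
    [/\ Ck 2 I f,
        forall s, I s ->
          derive1 (derive1 f) s
            = (et + e * derive1 f s ^+ 2) * (1 - derive1 f s * h s) &
        forall x, u x = f (pi x)]).
Proof.
have e0 : e != 0 by case: he => ->; rewrite ?oppr_eq0 oner_eq0.
have et2 : et ^+ 2 = 1 by case: het => ->; rewrite ?sqrrN expr1n.
have [_ rpi _] := hpi.
split=> [[uinv sol] | [f [C2f ode uE]]].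
  have [f uE] := invariant_factor horb uinv.
  have Cf := C2_at_submersion_factor hM hpi hu uE.
  exists f; split => //; first exact/Ck2_C2_at.
  move=> s; rewrite -rpi => -[x _ <-].
  have [_ _ _ /(_ x)[i ix] _] := hM.
  have jFx : dom ((i, tt) : chart_index (prod_space M real_line)) (graph_map u x).
    by split.
  apply: (soliton_equation_ode hM hg e0 et2 hpi hh hu Cf uE ix jFx
    (hF _ _ _ ix jFx)).1.
  exact: sol.
have Cf : forall s, I s -> C2_at f s by exact/Ck2_C2_at.
split=> [x a | i j p ip jFp G Phi].
  by rewrite !uE; congr f; apply/horb; exists a.
apply: (soliton_equation_ode hM hg e0 et2 hpi hh hu Cf uE ip jFp
  (hF _ _ _ ip jFp)).2.
by apply: ode; rewrite -rpi; exists p.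
Qed.
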